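(* Let $E$ be a real $d\times d$ matrix all of whose eigenvalues have positive real parts, and let $q=\operatorname{trace}(E)$. Let $\beta>0$ and let $\varphi:\mathbb{R}^d\to[0,\infty)$ be an $E$-homogeneous, $(\beta,E)$-admissible function. Then for any $0<\alpha\le 2$ and any $0<H<\beta$ the random field $$X_\varphi(x)=\int_{\mathbb{R}^d}\Bigl(\varphi(x-y)^{H-q/\alpha}-\varphi(-y)^{H-q/\alpha}\Bigr)\,Z_\alpha(dy),\qquad x\in\mathbb{R}^d,$$ exists and is stochastically continuous.
   Context: For $c>0$, $c^E=\exp(E\log c)$ (matrix exponential). There is a norm $\|\cdot\|_0$ on $\mathbb{R}^d$ with unit sphere $S_0=\{x:\|x\|_0=1\}$ such that $(r,\theta)\mapsto r^E\theta$ is a homeomorphism from $(0,\infty)\times S_0$ onto $\mathbb{R}^d\setminus\{0\}$ and, for each $x\neq0$, $t\mapsto\|t^Ex\|_0$ is strictly increasing; fix such a norm. Each $x\neq 0$ is uniquely written $x=\tau(x)^El(x)$ with $\tau(x)>0$, $l(x)\in S_0$; set $\tau(0)=0$ ($\tau$ is continuous). A function $\varphi$ on $\mathbb{R}^d$ is $E$-homogeneous if $\varphi(c^Ex)=c\varphi(x)$ for all $c>0$ and $x\ne0$. A continuous function $\varphi:\mathbb{R}^d\to[0,\infty)$ is $(\beta,E)$-admissible if $\varphi(x)>0$ for all $x\ne0$ and for any $0<A<B$ there is a constant $C>0$ such that, for all $A\le\|y\|\le B$ and all $x$ with $\tau(x)\le1$, $|\varphi(x+y)-\varphi(y)|\le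 C\tau(x)^\beta$. $Z_\alpha(dy)$ is an independently scattered symmetric $\alpha$-stable ($S\alpha S$) random measure on $\mathbb{R}^d$ with Lebesgue control measure. The integral $\int f\,dZ_\alpha$ of a measurable real function $f$ exists if and only if $\int_{\mathbb{R}^d}|f(y)|^\alpha dy<\infty$; it is linear in $f$ and has characteristic function $t\mapsto\exp(-|t|^\alpha\int|f(y)|^\alpha dy)$ (up to a normalizing constant). The field exists if the integral exists for every $x\in\mathbb{R}^d$. Stochastically continuous means continuous in probability at every $x_0\in\mathbb{R}^d$. *)

(* Defs.v *)
From HB Require Import structures.
From mathcomp Require Import all_boot all_order all_algebra.
From mathcomp Require Import complex.
From mathcomp Require Import all_classical all_reals all_analysis.

Set Implicit Arguments.
Unset Strict Implicit.
Unset Printing Implicit Defensive.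

Import Order.TTheory GRing.Theory Num.Theory.
Import numFieldNormedType.Exports.
Import HBSimple.

Local Open Scope classical_set_scope.
Local Open Scope ring_scope.

(* R^d is 'cV[R]_d, with the topology of the library (coordinatewise). Its
   measurable structure is the one generated by the coordinate maps, i.e. the
   d-fold product of the Borel sigma-algebra of R, which is the Borel
   sigma-algebra of R^d. *)
Section measurable_matrix.
Context {R : realType} (m n : nat).

Definition mx_cylinder : set (set 'M[R]_(m, n)) :=
  [set A | exists i j, exists2 B : set R,
     measurable B & A = (fun M : 'M[R]_(m, n) => M i j) @^-1` B].

Let mx_set0 : <<s mx_cylinder >> set0.
Proof. exact: sigma_algebra0. Qed.

Let mx_setC A : <<s mx_cylinder >> A -> <<s mx_cylinder >> (~` A).
Proof. exact: sigma_algebraC. Qed.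

Let mx_bigcup (F : (set 'M[R]_(m, n))^nat) :
  (forall i, <<s mx_cylinder >> (F i)) -> <<s mx_cylinder >> (\bigcup_i F i).
Proof. exact: sigma_algebra_bigcup. Qed.

HB.instance Definition _ := @isMeasurable.Build default_measure_display
  'M[R]_(m, n) <<s mx_cylinder >> mx_set0 mx_setC mx_bigcup.

End measurable_matrix.

Section measurable_matrix_theory.
Context {R : realType}.

Lemma measurable_mx_coord m n (i : 'I_m) (j : 'I_n) :
  measurable_fun [set: 'M[R]_(m, n)] (fun M : 'M[R]_(m, n) => M i j).
Proof.
by move=> _ B mB; rewrite setTI; apply: sub_sigma_algebra; exists i, j, B.
Qed.

Lemma measurable_fun_mx d (T : measurableType d) m n (f : T -> 'M[R]_(m, n)) :
  (forall i j, measurable_fun setT (fun t => f t i j)) -> measurable_fun setT f.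
Proof.
move=> mf; apply: (@measurability _ _ _ _ _ _ (@mx_cylinder R m n)) => //.
move=> _ [_ [i [j [B mB ->]]] <-].
by rewrite -comp_preimage; apply: (mf i j).
Qed.

Definition cons_cV n (p : R * 'cV[R]_n) : 'cV[R]_n.+1 := col_mx (p.1%:M) p.2.

Lemma measurable_cons_cV n : measurable_fun setT (@cons_cV n).
Proof.
apply: measurable_fun_mx => i j; rewrite /cons_cV.
case: (split_ordP (i : 'I_(1 + n))) => k ->.
- rewrite (_ : (fun _ => _) = fst); first exact: measurable_fst.
  by apply/funext => p; rewrite (@col_mxEu R 1 n 1) !ord1 mxE mulr1n.
- rewrite (_ : (fun _ => _) = (fun v : 'cV[R]_n => v k j) \o snd).
    by apply: measurableT_comp (@measurable_mx_coord _ _ _ _) _.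
  by apply/funext => p; rewrite (@col_mxEd R 1 n 1).
Qed.

End measurable_matrix_theory.

Section lebesgue_cV.
Context {R : realType}.

Section step.
Variables (n : nat) (mu : {sigma_finite_measure set 'cV[R]_n -> \bar R}).

Definition lebesgue_cons : set 'cV[R]_n.+1 -> \bar R :=
  pushforward (@lebesgue_measure R \x mu)%E (@cons_cV R n).

Let lebesgue_cons0 : lebesgue_cons set0 = 0%E.
Proof. by rewrite /lebesgue_cons /pushforward preimage_set0 measure0. Qed.

Let lebesgue_cons_ge0 A : (0 <= lebesgue_cons A)%E.
Proof. by rewrite /lebesgue_cons /pushforward; apply: measure_ge0. Qed.

Let lebesgue_cons_semi_sigma_additive : semi_sigma_additive lebesgue_cons.
Proof.
have mcons A : measurable A -> measurable (@cons_cV R n @^-1` A).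
  by move=> mA; rewrite -[X in measurable X]setTI; exact: measurable_cons_cV.
move=> F mF tF mUF; rewrite /lebesgue_cons /pushforward preimage_bigcup.
apply: measure_semi_sigma_additive.
- by move=> k; exact: mcons.
- apply/trivIsetP => /= i j _ _ ij; rewrite -preimage_setI.
  by move/trivIsetP : tF => /(_ _ _ _ _ ij) -> //; rewrite preimage_set0.
- by rewrite -preimage_bigcup; exact: mcons.
Qed.

HB.instance Definition _ := isMeasure.Build _ _ _ lebesgue_cons
  lebesgue_cons0 lebesgue_cons_ge0 lebesgue_cons_semi_sigma_additive.

Let lebesgue_cons_sigma_finite : sigma_finite setT lebesgue_cons.
Proof.
pose g (v : 'cV[R]_n.+1) : R * 'cV[R]_n := (v 0 0, @dsubmx R 1 n 1 v).
have mg : measurable_fun setT g.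
  apply: measurable_fun_pair; first exact: measurable_mx_coord.
  apply: measurable_fun_mx => i j.
  rewrite (_ : (fun _ => _) = (fun v : 'cV[R]_n.+1 => v (rshift 1 i) j)).
    exact: measurable_mx_coord.
  by apply/funext => v; rewrite mxE.
have gK p : g (@cons_cV R n p) = p.
  case: p => x v; rewrite /g /cons_cV col_mxKd; congr pair.
  by rewrite (_ : 0 = lshift n (0 : 'I_1)) ?(@col_mxEu R 1 n 1) ?mxE//; apply/val_inj.
have /sigma_finiteP[F [FT ndF Foo]] := sigma_finiteT (@lebesgue_measure R).
have /sigma_finiteP[G [GT ndG Goo]] := sigma_finiteT mu.
exists (fun k => g @^-1` (F k `*` G k)).
  rewrite -preimage_bigcup [X in g @^-1` X](_ : _ = setT)//.
  rewrite -setXTT FT GT predeqE => -[x y]; split.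
    by move=> [k _ []/= ? ?]; split; exists k.
  move=> [/= [k _ Fkx] [l _ Gly]]; exists (maxn k l) => //; split.
  - by move: x Fkx; exact/subsetPset/ndF/leq_maxl.
  - by move: y Gly; exact/subsetPset/ndG/leq_maxr.
move=> k; have [mF Fk] := Foo k; have [mG Gk] := Goo k; split.
  by rewrite -[X in measurable X]setTI; apply: mg => //; exact: measurableX.
rewrite /lebesgue_cons /pushforward -comp_preimage.
rewrite (_ : g \o _ = id); last by apply/funext => p /=.
by rewrite preimage_id product_measure1E// lte_mul_pinfty// ge0_fin_numE.
Qed.

HB.instance Definition _ := Measure_isSigmaFinite.Build _ _ _ lebesgue_cons
  lebesgue_cons_sigma_finite.

End step.

(* Lebesgue measure on R^n, as the n-fold product of that of R. *)
Fixpoint lebesgue_cV (n : nat) : {sigma_finite_measure set 'cV[R]_n -> \bar R} :=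
  match n with
  | 0 => [the {sigma_finite_measure set 'cV[R]_0 -> \bar R} of
            @dirac _ 'cV[R]_0 0 R]
  | n'.+1 => [the {sigma_finite_measure set 'cV[R]_n'.+1 -> \bar R} of
            lebesgue_cons (lebesgue_cV n')]
  end.

End lebesgue_cV.

Section operator_scaling.
Context {R : realType} {d : nat}.
Implicit Types (E A : 'M[R]_d) (x y : 'cV[R]_d) (N : 'cV[R]_d -> R).

Definition expmx A : 'M[R]_d :=
  limn (series (fun k : nat => (k`!%:R)^-1 *: A ^+ k)).

Definition powmx (c : R) E : 'M[R]_d := expmx (ln c *: E).

Definition positive_spectrum E : Prop :=
  forall z : R[i], eigenvalue (map_mx (real_complex R) E) z ->
    0 < complex.Re z.

Definition is_norm N : Prop :=
  [/\ forall x, 0 <= N x,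
      forall x, N x = 0 -> x = 0,
      forall (a : R) x, N (a *: x) = `|a| * N x
    & forall x y, N (x + y) <= N x + N y].

Definition homeomorphism_onto {T U : topologicalType} (A : set T) (B : set U)
    (f : T -> U) : Prop :=
  set_bij A B f /\ {within A, continuous f} /\
  exists g : U -> T, {within B, continuous g} /\ {in A, cancel f g}.

Definition adapted_norm E N : Prop :=
  [/\ is_norm N,
      homeomorphism_onto [set p : R * 'cV[R]_d | 0 < p.1 /\ N p.2 = 1]
        [set x : 'cV[R]_d | x != 0] (fun p => powmx p.1 E *m p.2)
    & forall x, x != 0 -> forall s t : R, 0 < s -> s < t ->
        N (powmx s E *m x) < N (powmx t E *m x)].

Definition tau E N x : R :=
  if x == 0 then 0
  else xget 0 [set r | 0 < r /\
    exists theta : 'cV[R]_d, N theta = 1 /\ x = powmx r E *m theta].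

(* The library norm on matrices is the max norm, hence this Euclidean norm. *)
Definition enorm x : R := Num.sqrt (\sum_(i < d) x i 0 ^+ 2).

Definition homogeneous_fun E (phi : 'cV[R]_d -> R) : Prop :=
  forall (c : R) x, 0 < c -> x != 0 -> phi (powmx c E *m x) = c * phi x.

Definition admissible_fun (beta : R) E N (phi : 'cV[R]_d -> R) : Prop :=
  [/\ continuous phi,
      forall x, 0 <= phi x,
      forall x, x != 0 -> 0 < phi x
    & forall a b : R, 0 < a -> a < b -> exists C : R, 0 < C /\
        forall x y, a <= enorm y <= b -> tau E N x <= 1 ->
          `|phi (x + y) - phi y| <= C * tau E N x `^ beta].

(* For a negative exponent the kernel is infinite at y = x and y = 0 on paper,
   whereas [0 `^ p] is then 0; these two points are Lebesgue-null. *)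
Definition ma_kernel E (phi : 'cV[R]_d -> R) (alpha H : R) x y : R :=
  phi (x - y) `^ (H - \tr E / alpha) - phi (- y) `^ (H - \tr E / alpha).

End operator_scaling.

Section stable_integral.
Context {R : realType} {dO : measure_display} {Omega : measurableType dO}.
Variable P : probability Omega R.

Definition cvg_in_prob {I : Type} (F : set_system I) (X : I -> Omega -> R)
    (Y : Omega -> R) : Prop :=
  forall eps : R, 0 < eps ->
    (fun i => P [set w | eps <= `|X i w - Y w|]) @ F --> 0%E.

Definition stochastically_continuous {T : topologicalType}
    (X : T -> {RV P >-> R}) : Prop :=
  forall x0 : T, cvg_in_prob (nbhs x0) X (X x0).

Definition mutually_independent n (X : 'I_n -> {RV P >-> R}) : Prop :=
  forall B : 'I_n -> set R, (forall i, measurable (B i)) ->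
    P (\bigcap_(i in setT) (X i @^-1` B i)) = (\prod_(i < n) P (X i @^-1` B i))%E.

(* [X] has characteristic function [exp (- s |t|^alpha)], written through its
   real and imaginary parts. *)
Definition SaS_law (alpha s : R) (X : {RV P >-> R}) : Prop :=
  forall t : R,
    ('E_P[fun w => cos (t * X w)%R] = (expR (- (`|t| `^ alpha * s)))%:E)%E /\
    ('E_P[fun w => sin (t * X w)%R] = 0)%E.

Context {d : nat}.
Notation leb := (@lebesgue_cV R d).

Definition finite_borel (A : set 'cV[R]_d) : Prop :=
  measurable A /\ (leb A < +oo)%E.

(* [Z] is only meaningful on [finite_borel] sets. *)
Definition SaS_random_measure (alpha : R) (Z : set 'cV[R]_d -> {RV P >-> R}) :
    Prop :=
  [/\ forall A, finite_borel A -> SaS_law alpha (fine (leb A)) (Z A),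
      forall n (A : 'I_n -> set 'cV[R]_d), (forall i, finite_borel (A i)) ->
        trivIset setT A -> mutually_independent (fun i => Z (A i))
    & forall A : nat -> set 'cV[R]_d, (forall k, finite_borel (A k)) ->
        trivIset setT A -> finite_borel (\bigcup_k A k) ->
        {ae P, forall w, series (fun k => Z (A k) w) @ \oo -->
                         (Z (\bigcup_k A k) w : R)}].

Definition Lalpha (alpha : R) (f : 'cV[R]_d -> R) : Prop :=
  measurable_fun setT f /\ (\int[leb]_y (`|f y| `^ alpha)%:E < +oo)%E.

Definition simple_integral (Z : set 'cV[R]_d -> {RV P >-> R})
    (f : {sfun 'cV[R]_d >-> R}) (w : Omega) : R :=
  \sum_(c \in range f) c * Z (f @^-1` [set c]) w.

(* [Y] is (a version of) the integral of [f] against [Z]: [f] is in L^alpha and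
   [Y] is the limit in probability of the integrals of simple functions that
   converge to [f] in L^alpha. For a simple function, membership in L^alpha
   means that it vanishes outside a set of finite measure. *)
Definition is_stable_integral (alpha : R) (Z : set 'cV[R]_d -> {RV P >-> R})
    (f : 'cV[R]_d -> R) (Y : {RV P >-> R}) : Prop :=
  Lalpha alpha f /\
  exists fn : nat -> {sfun 'cV[R]_d >-> R},
    [/\ forall n, Lalpha alpha (fn n),
        (fun n => \int[leb]_y (`|fn n y - f y| `^ alpha)%:E)%E @ \oo --> 0%E
      & cvg_in_prob \oo (fun n => simple_integral Z (fn n)) Y].

Definition stable_integral_exists (alpha : R)
    (Z : set 'cV[R]_d -> {RV P >-> R}) (f : 'cV[R]_d -> R) : Prop :=
  exists Y : {RV P >-> R}, is_stable_integral alpha Z f Y.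

End stable_integral.

(* Main.v *)
Require Import Defs.
From HB Require Import structures.
From mathcomp Require Import all_boot all_order all_algebra fingroup perm finmap.
From mathcomp Require Import all_classical all_reals all_analysis.
From mathcomp Require Import measurable_realfun simple_functions measurable_fun_approximation.
From mathcomp Require Import ring lra.
Import Order.TTheory GRing.Theory Num.Theory.
Import numFieldNormedType.Exports.
Import HBSimple.
Local Open Scope classical_set_scope.
Local Open Scope ring_scope.
Set Implicit Arguments.
Unset Strict Implicit.
Unset Printing Implicit Defensive.

(** Write [q] for the trace of [E] and [p = H - q / alpha] for the exponent of
the kernel. Two estimates carry the theorem.

The first is analytic. The substitution [z = x0 - y] preserves Lebesgue measure
and turns the [alpha]-th power of the distance between the kernels at [x] and
at [x0] into [J (x - x0)], where [J x] is the integral over [z] of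
[|phi (x + z)^p - phi z^p|^alpha]. The substitution [z = c^E z'] multiplies
Lebesgue measure by [det (c^E) = c^q] and [phi] by [c]; as
[p alpha + q = H alpha], this gives [J (c^E x) = c^(H alpha) J x], and it
suffices to bound [J] on the set [{phi = 1}]. There, where [phi z] is large,
admissibility rescaled by homogeneity bounds the increment by a multiple of
[phi z^(p - beta)], whose [alpha]-th power is integrable at infinity since
[(p - beta) alpha + q = (H - beta) alpha < 0]. Where [phi z] is bounded, the two
terms of the increment are integrated separately, and [phi^(p alpha)] is
integrable near 0 since [p alpha + q = H alpha > 0]. Both integrability claims
come from cutting space into the images of one shell of [phi] under the powers
of [2^E], which yields a geometric series ([geometric_cover_lty]). The outcome is
[J x <= C phi x^(H alpha)] ([integral_increment_le], [ma_kernel_dist]); taking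
[x0 = 0], where the kernel vanishes, shows that every kernel is in L^alpha.

The second is probabilistic. The integrals of two simple functions [f] and [g]
differ by a linear combination of independent stable variables, hence by a
variable with characteristic function [exp (- |t|^alpha s)], where [s] is the
integral of [|f - g|^alpha]. A tail bound read off from this characteristic
function ([SaS_char_markov]) shows that the difference exceeds [eps] with
probability at most a constant times [eps^(- alpha) s]
([simple_integral_dist]). Since simple functions are dense in L^alpha
([simple_dense]) and convergence in probability is complete
([probability_complete]), every function in L^alpha has a stable integral
([stable_integral_existence]), and the bound survives in the limit
([stable_integral_dist]).

Together, the two estimates bound the probability that the field moves by more
than [eps] between [x0] and [x] by a constant times [phi (x - x0)^(H alpha)],
which tends to 0 because [phi] is continuous and vanishes at 0. *)

(** * Real powers, geometric sums and limits *)

Section real_powers.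
Context {R : realType}.

(** Since [u^p = exp (p ln u)], this follows from the tangent-line bounds of [ln]
and [exp]; the interval keeps [u] away from 0, where the slope of [u^p] may be
unbounded. *)
Lemma powR_sub1_le (p : R) : exists2 C : R, 0 < C &
  forall u, 2^-1 <= u <= 3 / 2 -> `|u `^ p - 1| <= C * `|u - 1|.
Proof.
exists (2 * `|p| * expR `|p| + 1); first by rewrite ltr_wpDl ?mulr_ge0 ?expR_ge0.
move=> u /andP[u1 u2]; have u0 : 0 < u by lra.
have ln_le v : 0 < v -> ln v <= v - 1 :> R.
  move=> v0; rewrite -[X in ln X](subrK 1) addrC le_ln1Dx//; lra.
have lnu : `|ln u| <= 2 * `|u - 1|.
  have l1 : ln u <= u - 1 by exact: ln_le.
  have l2 : - ln u <= u^-1 - 1.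
    by rewrite -lnV ?posrE//; apply: ln_le; rewrite invr_gt0.
  have l3 : u^-1 - 1 <= 2 * `|u - 1|.
    have -> : u^-1 - 1 = u^-1 * (1 - u) by field; rewrite gt_eqF.
    rewrite (@le_trans _ _ (u^-1 * `|u - 1|))//.
      by rewrite ler_wpM2l ?invr_ge0 ?(ltW u0)// distrC ler_norm.
    by rewrite ler_wpM2r// -[leRHS]invrK lef_pV2 ?posrE.
  rewrite ler_norml; apply/andP; split; first by rewrite lerNl (le_trans l2).
  rewrite (le_trans l1)// (le_trans (ler_norm _))// -[leLHS]mul1r.
  by rewrite ler_wpM2r// ler1n.
have expB (z : R) : `|expR z - 1| <= `|z| * expR `|z|.
  have e1 : 1 + z <= expR z by exact: expR_ge1Dx.
  have e2 : 1 - z <= expR (- z) by exact: expR_ge1Dx.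
  have e3 : expR z <= expR `|z| by rewrite ler_expR ler_norm.
  have e4 : 1 <= expR `|z| by rewrite -expR0 ler_expR.
  have ep : 0 < expR z by exact: expR_gt0.
  have eE : expR z * expR (- z) = 1 by rewrite -expRD subrr expR0.
  have [z0|z0] := leP 0 z.
    rewrite (ger0_norm z0) in e3 e4 *; rewrite ger0_norm; last by lra.
    nra.
  rewrite (ltr0_norm z0) in e3 e4 *; rewrite ler0_norm; nra.
rewrite /powR gt_eqF//.
rewrite (le_trans (expB _))// normrM.
have lp : `|p| * `|ln u| <= `|p| * (2 * `|u - 1|) by rewrite ler_wpM2l.
have u11 : `|u - 1| <= 2^-1 by rewrite ler_norml; apply/andP; split; lra.
have lp2 : expR (`|p| * `|ln u|) <= expR `|p|.
  rewrite ler_expR; rewrite (le_trans lp)// -[leRHS]mulr1 ler_wpM2l//.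
  by rewrite -ler_pdivlMl// mulr1.
rewrite (@le_trans _ _ (`|p| * (2 * `|u - 1|) * expR `|p|))//.
  by apply: ler_pM => //; rewrite ?mulr_ge0 ?expR_ge0.
rewrite -subr_ge0 (_ : _ - _ = `|u - 1|)//; ring.
Qed.

Lemma powR_interval_le (a b x g : R) : 0 < a -> a <= x <= b ->
  x `^ g <= a `^ g + b `^ g.
Proof.
move=> a0 /andP[ax xb]; have x0 : 0 < x by exact: lt_le_trans ax.
have b0 : 0 < b by exact: lt_le_trans xb.
have [g0|g0] := leP 0 g.
  by rewrite ler_wpDl ?powR_ge0// ge0_ler_powR ?nnegrE// ltW.
rewrite ler_wpDr ?powR_ge0// -(opprK g) !(powRN _ (- g)).
rewrite lef_pV2 ?posrE ?powR_gt0// ge0_ler_powR ?nnegrE ?(ltW a0) ?(ltW x0)//.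
by rewrite oppr_ge0 ltW.
Qed.

Lemma powR_dist_le (a b c : R) : 0 <= a -> 0 <= b -> 0 <= c ->
  `|a - b| `^ c <= a `^ c + b `^ c.
Proof.
move=> a0 b0 c0; wlog ab : a b a0 b0 / a <= b.
  move=> H; have [ab|/ltW ba] := leP a b; first exact: H.
  by rewrite distrC [leRHS]addrC; exact: H.
rewrite ler_wpDl ?powR_ge0// ge0_ler_powR ?nnegrE//.
by rewrite ler0_norm ?subr_le0// opprB gerBl.
Qed.

Lemma powR_inv2_lt1 (alpha : R) : 0 < alpha -> (2^-1 : R) `^ alpha < 1.
Proof.
move=> a0; rewrite /powR gt_eqF ?invr_gt0// expR_lt1 pmulr_rlt0// ln_lt0//.
by rewrite invr_gt0 ltr0n invf_lt1// ltr1n.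
Qed.

Section positive_exponent.
Variable alpha : R.
Hypothesis alpha_gt0 : 0 < alpha.

(** The constant [2^alpha] serves all positive exponents, on both sides of
[alpha = 1]: the larger of [|a|] and [|b|] is at least half of [|a + b|]. *)
Lemma powR_normD_le (a b : R) :
  `|a + b| `^ alpha <= 2 `^ alpha * (`|a| `^ alpha + `|b| `^ alpha).
Proof.
wlog ab : a b / `|a| <= `|b|.
  move=> H; have [ab|/ltW ba] := leP `|a| `|b|; first exact: H.
  by rewrite [a + b]addrC [X in _ * X]addrC; exact: H.
apply: (@le_trans _ _ ((2 * `|b|) `^ alpha)).
  rewrite ge0_ler_powR ?nnegrE ?(ltW alpha_gt0) ?mulr_ge0//.
  by rewrite (le_trans (ler_normD _ _))// mulr_natl mulr2n lerD2r.
by rewrite powRM// ler_wpM2l ?powR_ge0// lerDr powR_ge0.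
Qed.

Lemma powR_lt_root (a e : R) : 0 <= a -> 0 < e -> a < e `^ alpha^-1 -> a `^ alpha < e.
Proof.
move=> a0 e0 ae; have -> : e = (e `^ alpha^-1) `^ alpha.
  by rewrite -powRrM mulVf ?gt_eqF// powRr1// ltW.
by rewrite gt0_ltr_powR// ?nnegrE// powR_ge0.
Qed.

Lemma powR_cvg0_comp T (F : set_system T) {FF : Filter F} (u : T -> R) :
  (forall n, 0 <= u n) -> u @ F --> 0 -> (fun n => u n `^ alpha) @ F --> 0.
Proof.
move=> u0 /cvgrPdist_lt uF; apply/cvgrPdist_lt => e e0.
have := uF (e `^ alpha^-1) (powR_gt0 _ e0).
apply: filterS => n; rewrite !sub0r !normrN !ger0_norm ?powR_ge0//.
exact: powR_lt_root.
Qed.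

End positive_exponent.

End real_powers.

Section limits.
Context {R : realType}.

Lemma ereal_cvg0_lt T (F : set_system T) {FF : Filter F} (u : T -> \bar R) (e : R) :
  u @ F --> 0%E -> 0 < e -> \forall n \near F, (u n < e%:E)%E.
Proof.
move=> uF e0; suff N : nbhs 0%E [set y | (y < e%:E)%E] by exact: (uF _ N).
by apply: open_nbhs_nbhs; split; [exact: open_ereal_lt_ereal|rewrite /= lte_fin].
Qed.

Lemma ereal_cvg0 T (F : set_system T) {FF : Filter F} (u : T -> \bar R) :
  (forall i, 0 <= u i)%E ->
  (forall e : R, 0 < e -> \forall i \near F, (u i <= e%:E)%E) -> u @ F --> 0%E.
Proof.
move=> u0 ue; apply/fine_cvgP; split.
  apply: filterS (ue 1 ltr01) => i ui.
  by rewrite ge0_fin_numE// (le_lt_trans ui)// ltry.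
apply/cvgrPdist_le => e e0; apply: filterS (ue e e0) => i ui /=.
rewrite sub0r normrN ger0_norm ?fine_ge0//.
by rewrite -lee_fin fineK// ge0_fin_numE// (le_lt_trans ui)// ltry.
Qed.

Lemma nneseries_geometric_lty (r : R) (a : \bar R) : 0 <= r -> r < 1 ->
  (0 <= a)%E -> (a < +oo)%E -> (\sum_(k <oo) ((r ^+ k)%:E * a) < +oo)%E.
Proof.
move=> r0 r1 a0 aoo.
have afin : a \is a fin_num by rewrite ge0_fin_numE.
rewrite -(fineK afin).
rewrite (_ : limn _ = (fine a * (1 - r)^-1)%:E) ?ltry//.
apply: cvg_lim => //.
rewrite (_ : (fun n => _) = EFin \o series (geometric (fine a) r)); last first.
  apply/funext => n /=; rewrite /series/= -sumEFin; apply: eq_bigr => k _.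
  by rewrite -EFinM mulrC.
apply: cvg_EFin; first exact: nearW.
by apply: cvg_geometric_series; rewrite ger0_norm.
Qed.

Lemma exists_exp2_ge (x : R) : exists n : nat, x < 2 ^+ n.
Proof.
exists (Num.truncn x).+1.
rewrite (lt_trans (truncnS_gt _))// -natrX ltr_nat.
exact: ltn_expl.
Qed.

Lemma dyadic_down (s M : R) : 0 < s -> s <= M -> exists n : nat, M / 2 < s * 2 ^+ n <= M.
Proof.
move=> s0 sM; have M0 : 0 < M by exact: lt_le_trans sM.
have ex : exists n : nat, M / 2 < s * 2 ^+ n.
  have [n nP] := exists_exp2_ge (M / 2 / s).
  by exists n; rewrite [s * _]mulrC -ltr_pdivrMr.
case: (ex_minnP ex) => -[|n] nP min_n; first by exists 0%N; rewrite nP expr0 mulr1.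
exists n.+1; rewrite nP/= exprS mulrCA.
have : s * 2 ^+ n <= M / 2 by rewrite leNgt; apply/negP => /min_n; rewrite ltnn.
by rewrite ler_pdivlMr// mulrC.
Qed.

Lemma dyadic_up (s M : R) : 0 < M -> M < s ->
  exists n : nat, M < s * 2^-1 ^+ n <= M * 2.
Proof.
move=> M0 Ms; have s0 : 0 < s by exact: lt_trans Ms.
have ex : exists n : nat, s * 2^-1 ^+ n <= M * 2.
  have [n nP] := exists_exp2_ge (s / (M * 2)).
  exists n; rewrite exprVn ler_pdivrMr ?exprn_gt0// mulrC -ler_pdivrMr ?mulr_gt0//.
  exact: ltW.
case: (ex_minnP ex) => -[|n] nP min_n.
  by exists 0%N; rewrite nP expr0 mulr1 Ms.
exists n.+1; rewrite nP andbT exprS mulrCA.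
have : M * 2 < s * 2^-1 ^+ n by rewrite ltNge; apply/negP => /min_n; rewrite ltnn.
by rewrite ltr_pdivlMl// mulrC.
Qed.

Lemma geometric_small (e : R) : 0 < e -> exists n0, forall k, (n0 <= k)%N ->
  2 * 2^-1 ^+ k < e.
Proof.
move=> e0; have [n0 n0P] := exists_exp2_ge (2 / e); exists n0 => k nk.
have : 2 * 2^-1 ^+ n0 < e by rewrite exprVn ltr_pdivrMr ?exprn_gt0// mulrC -ltr_pdivrMr.
apply: le_lt_trans; rewrite ler_pM2l// ler_wiXn2l// ?invr_ge0//.
by rewrite invf_le1// ler1n.
Qed.

Lemma geometric_cauchy (u : nat -> R) N :
  (forall k, (N <= k)%N -> `|u k - u k.+1| <= 2^-1 ^+ k) ->
  exists2 l, u @ \oo --> l & forall k, (N <= k)%N -> `|u k - l| <= 2 * 2^-1 ^+ k.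
Proof.
move=> uN.
have step k j : (N <= k)%N -> `|u k - u (k + j)%N| <= 2 * 2^-1 ^+ k - 2 * 2^-1 ^+ (k + j).
  move=> Nk; elim: j => [|j IH]; first by rewrite addn0 !subrr normr0.
  rewrite (le_trans (ler_distD (u (k + j)%N) _ _))// addnS.
  rewrite (le_trans (lerD IH (uN _ _)))//; first exact: leq_trans (leq_addr _ _).
  by rewrite exprS mulrA mulfV ?mul1r//; lra.
have step2 k m : (N <= k)%N -> (k <= m)%N -> `|u k - u m| <= 2 * 2^-1 ^+ k.
  move=> Nk km; rewrite -(subnKC km) (le_trans (step _ _ Nk))// gerBl.
  by rewrite mulr_ge0// exprn_ge0.
have cu : cvgn u.
  apply: cauchy_cvg; apply: cauchy_exP => e e0.
  have [n0 n0P] := geometric_small e0.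
  exists (u (maxn N n0)); exists (maxn N n0) => // m /= Nm.
  rewrite /ball/= (le_lt_trans (step2 _ _ (leq_maxl _ _) Nm))//.
  exact/n0P/leq_maxr.
exists (limn u) => // k Nk.
have cd : (fun m => `|u k - u m|) @ \oo --> `|u k - limn u|.
  by apply: cvg_norm; apply: cvgB => //; exact: cvg_cst.
rewrite -(cvg_lim (@Rhausdorff R) cd); apply: limr_le; first exact/cvgP/cd.
by exists k => // m /= km; exact: step2.
Qed.

End limits.

(** * Linear changes of variables for Lebesgue measure *)

Section scaling_maps.
Context {R : realType}.
Local Open Scope ereal_scope.

(** The factor is the inverse of the Jacobian determinant: with preimages instead
of images, integrals of [h \o f] transform directly and factors of composed maps
multiply. *)
Definition scales d (T : measurableType d) (m : {measure set T -> \bar R})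
    (f : T -> T) (k : R) :=
  [/\ measurable_fun setT f, (0 <= k)%R &
    forall B, measurable B -> m (f @^-1` B) = k%:E * m B].

Section integral.
Context d (T : measurableType d) (m : {measure set T -> \bar R}).
Variables (f : T -> T) (k : R).

Lemma scales_integral (h : T -> \bar R) : scales m f k ->
  measurable_fun setT h -> (forall x, 0 <= h x) ->
  \int[m]_x h (f x) = k%:E * \int[m]_x h x.
Proof.
move=> [mf k0 fE] mh h0.
transitivity (\int[pushforward m f]_x h x).
  by rewrite ge0_integral_pushforward// preimage_setT.
rewrite -(@ge0_integral_mscale _ _ _ m _ measurableT (NngNum k0) h)//.
by apply: eq_measure_integral => B mB _; exact: fE.
Qed.

End integral.

Lemma scales_comp d (T : measurableType d) (m : {measure set T -> \bar R})
  f g k l : scales m f k -> scales m g l -> scales m (g \o f) (k * l)%R.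
Proof.
move=> [mf k0 fE] [mg l0 gE]; split; first exact: measurableT_comp.
  exact: mulr_ge0.
move=> B mB; rewrite comp_preimage fE ?gE ?EFinM ?muleA//.
by rewrite -[X in measurable X]setTI; exact: mg.
Qed.

Section product.
Context d1 d2 (T1 : measurableType d1) (T2 : measurableType d2).
Variables (m1 : {sigma_finite_measure set T1 -> \bar R})
  (m2 : {sigma_finite_measure set T2 -> \bar R}).

Lemma product_measure12 A : measurable A -> (m1 \x m2) A = (m1 \x^ m2) A.
Proof.
by move=> mA; apply: product_measure_unique => // X Y mX mY; exact: product_measure2E.
Qed.

(** Fubini for a skew product. The fibre maps [g x] may vary with [x] as long as
their factor does not, so that shears are covered. *)
Lemma scales_prod1 (f : T1 -> T1) (g : T1 -> T2 -> T2) k l :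
  measurable_fun setT (fun p : T1 * T2 => (f p.1, g p.1 p.2)) ->
  scales m1 f k -> (0 <= l)%R -> (forall x, scales m2 (g x) l) ->
  scales (m1 \x m2) (fun p => (f p.1, g p.1 p.2)) (k * l)%R.
Proof.
move=> mF sf l0 sg; have [mf k0 _] := sf.
split => //; first exact: mulr_ge0.
move=> B mB; rewrite /product_measure1/=.
transitivity (\int[m1]_x (l%:E * (m2 \o xsection B) (f x))).
  apply: eq_integral => x _ /=.
  have [_ _ <-] := sg x; last exact: measurable_xsection.
  by congr (m2 _); apply/seteqP; split => y; rewrite /xsection/= !inE.
rewrite ge0_integralZl//; last first.
  by apply: measurableT_comp => //; exact: measurable_fun_xsection.
rewrite (scales_integral sf) 1?muleA 1?mulrC//; exact: measurable_fun_xsection.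
Qed.

Lemma scales_prod2 (f : T2 -> T1 -> T1) (g : T2 -> T2) k l :
  measurable_fun setT (fun p : T1 * T2 => (f p.2 p.1, g p.2)) ->
  scales m2 g l -> (0 <= k)%R -> (forall y, scales m1 (f y) k) ->
  scales (m1 \x m2) (fun p => (f p.2 p.1, g p.2)) (k * l)%R.
Proof.
move=> mF sg k0 sf; have [mg l0 _] := sg.
split => //; first exact: mulr_ge0.
move=> B mB.
pose F (p : T1 * T2) := (f p.2 p.1, g p.2).
have mFB : measurable (F @^-1` B) by rewrite -[X in measurable X]setTI; exact: mF.
have /= -> := product_measure12 mFB; have /= -> := product_measure12 mB.
rewrite /product_measure2/=.
transitivity (\int[m2]_x (k%:E * (m1 \o ysection B) (g x))).
  apply: eq_integral => x _ /=.
  have [_ _ <-] := sf x; last exact: measurable_ysection.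
  by congr (m1 _); apply/seteqP; split => y; rewrite /ysection/= !inE.
rewrite ge0_integralZl//; last first.
  by apply: measurableT_comp => //; exact: measurable_fun_ysection.
rewrite (scales_integral sg) 1?muleA//; exact: measurable_fun_ysection.
Qed.

End product.

(** The pushforward of Lebesgue measure, multiplied by [|a|], agrees with Lebesgue
measure on half-open intervals. *)
Lemma scales_affine (a t : R) : (a != 0)%R ->
  scales (@lebesgue_measure R) (fun x : R => a * x + t)%R `|a|^-1.
Proof.
move=> a0.
have mf : measurable_fun setT (fun x : R => a * x + t)%R.
  by apply: measurable_funD => //; exact: measurable_funM.
have na0 : (0 < `|a|)%R by rewrite normr_gt0.
split => //.
pose g : R -> R := fun x => (a * x + t)%R.
have na0' : (0 <= `|a|)%R by [].
have mg : @measurable_fun _ _ (measurableTypeR R) (measurableTypeR R) setT g by exact: mf.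
pose mu1 : {measure set (measurableTypeR R) -> \bar R} :=
  measure_function_pushforward__canonical__measure_function_Measure (@lebesgue_measure R) mg.
pose mu := mscale (NngNum na0') mu1.
have E : forall B, measurable B -> @lebesgue_measure R B = mu B.
  apply: lebesgue_measure_unique => _ [[u v] /= _ <-].
  have [uv|uv] := ltP u v; last first.
    by rewrite set_itv_ge ?bnd_simp -?leNgt// !measure0.
  rewrite /mu /mscale /= /pushforward.
  have [al|ag] := ltP a 0%R.
    (* A decreasing map exchanges the closed and the open end of the interval. *)
    rewrite (_ : _ @^-1` _ = `[((v - t) / a)%R, ((u - t) / a)%R[%classic); last first.
      apply/seteqP; split => x /=; rewrite !in_itv/= /g.
        by rewrite ler_ndivrMr// ltr_ndivlMr// ltrBlDr lerBrDr mulrC => /andP[-> ->].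
      by rewrite ler_ndivrMr// ltr_ndivlMr// ltrBlDr lerBrDr mulrC => /andP[-> ->].
    rewrite !lebesgue_measure_itv/= !lte_fin uv ltr_nM2r ?invr_lt0// ltrD2r uv.
    rewrite -!EFinB -EFinM; congr EFin; rewrite ltr0_norm//; field.
    by rewrite lt_eqF.
  have {}ag : (0 < a)%R by rewrite lt_neqAle eq_sym a0.
  rewrite (_ : _ @^-1` _ = `]((u - t) / a)%R, ((v - t) / a)%R]%classic); last first.
    apply/seteqP; split => x /=; rewrite !in_itv/= /g.
      by rewrite ler_pdivlMr// ltr_pdivrMr// ltrBlDr lerBrDr mulrC => /andP[-> ->].
    by rewrite ler_pdivlMr// ltr_pdivrMr// ltrBlDr lerBrDr mulrC => /andP[-> ->].
  rewrite !lebesgue_measure_itv/= !lte_fin uv ltr_pM2r ?invr_gt0// ltrD2r uv.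
  by rewrite -!EFinB -EFinM; congr EFin; rewrite gtr0_norm//; field.
move=> B mB; transitivity ((`|a|^-1)%:E * mu B).
  by rewrite /mu /mscale/= /pushforward muleA -EFinM mulVf ?mul1e// gt_eqF.
by congr (_ * _); exact/esym/E.
Qed.

End scaling_maps.

Section lebesgue_linear.
Context {R : realType}.
Notation leb n := (@lebesgue_cV R n).

Lemma measurable_fun_linmap m n (A : 'M[R]_(m, n)) :
  measurable_fun [set: 'cV[R]_n] (fun x : 'cV[R]_n => A *m x).
Proof.
apply: measurable_fun_mx => i j.
rewrite (_ : (fun _ => _) = (fun x : 'cV[R]_n => \sum_k A i k * x k j)).
  apply: measurable_sum => k; apply: measurable_funM => //.
  exact: measurable_mx_coord.
by apply/funext => x; rewrite mxE.
Qed.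

Lemma measurable_fun_addcV d (T : measurableType d) n (f g : T -> 'cV[R]_n) :
  measurable_fun setT f -> measurable_fun setT g ->
  measurable_fun setT (fun x => f x + g x).
Proof.
move=> mf mg; apply: measurable_fun_mx => i j.
rewrite (_ : (fun _ => _) = (fun x => f x i j + g x i j)).
  apply: measurable_funD.
    apply: (@measurableT_comp _ _ _ _ _ _ (fun M : 'cV[R]_n => M i j)) => //.
    exact: measurable_mx_coord.
  apply: (@measurableT_comp _ _ _ _ _ _ (fun M : 'cV[R]_n => M i j)) => //.
  exact: measurable_mx_coord.
by apply/funext => x; rewrite mxE.
Qed.

Definition uncons_cV n (v : 'cV[R]_n.+1) : R * 'cV[R]_n :=
  (v 0 0, @dsubmx R 1 n 1 v).

Lemma cons_cVK n : cancel (@cons_cV R n) (@uncons_cV n).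
Proof.
case=> x v; rewrite /uncons_cV /cons_cV col_mxKd; congr pair.
by rewrite (_ : 0 = lshift n (0 : 'I_1)) ?(@col_mxEu R 1 n 1) ?mxE//; apply/val_inj.
Qed.

Lemma uncons_cVK n : cancel (@uncons_cV n) (@cons_cV R n).
Proof.
move=> v; rewrite /uncons_cV /cons_cV/=.
rewrite (_ : (v 0 0)%:M = @usubmx R 1 n 1 v) ?vsubmxK//.
apply/matrixP => i j; rewrite !mxE !ord1 mulr1n.
by congr (v _ _); apply/val_inj.
Qed.

Lemma measurable_uncons_cV n : measurable_fun setT (@uncons_cV n).
Proof.
apply: measurable_fun_pair; first exact: measurable_mx_coord.
apply: measurable_fun_mx => i j.
rewrite (_ : (fun _ => _) = (fun v : 'cV[R]_n.+1 => v (rshift 1 i) j)).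
  exact: measurable_mx_coord.
by apply/funext => v; rewrite mxE.
Qed.

Lemma lebesgue_cVS n B :
  leb n.+1 B = (@lebesgue_measure R \x leb n)%E (@cons_cV R n @^-1` B).
Proof. by []. Qed.

Section scales_cons.
Variables (n : nat) (T : 'cV[R]_n.+1 -> 'cV[R]_n.+1).
Hypothesis mT : measurable_fun setT T.

Let scales_cons (F : R * 'cV[R]_n -> R * 'cV[R]_n) k :
  (forall p, T (cons_cV p) = cons_cV (F p)) ->
  scales (@lebesgue_measure R \x leb n)%E F k -> scales (leb n.+1) T k.
Proof.
move=> TF [mF k0 FE]; split => // B mB.
have mB' : measurable (@cons_cV R n @^-1` B).
  by rewrite -[X in measurable X]setTI; exact: measurable_cons_cV.
apply: etrans (FE _ mB'); rewrite [LHS]lebesgue_cVS.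
by congr (product_measure1 _ _ _); apply/seteqP; split => p /=; rewrite TF.
Qed.

Let measurable_conj (F : R * 'cV[R]_n -> R * 'cV[R]_n) :
  (forall p, T (cons_cV p) = cons_cV (F p)) -> measurable_fun setT F.
Proof.
move=> TF; rewrite (_ : F = @uncons_cV n \o T \o @cons_cV R n); last first.
  by apply/funext => p /=; rewrite TF cons_cVK.
apply: measurableT_comp; last exact: measurable_cons_cV.
by apply: measurableT_comp => //; exact: measurable_uncons_cV.
Qed.

Lemma scales_cons1 (f : R -> R) (g : R -> 'cV[R]_n -> 'cV[R]_n) k l :
  (forall x v, T (cons_cV (x, v)) = cons_cV (f x, g x v)) ->
  scales (@lebesgue_measure R) f k -> 0 <= l ->
  (forall x, scales (leb n) (g x) l) -> scales (leb n.+1) T (k * l).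
Proof.
move=> TE sf l0 sg.
have TF p : T (cons_cV p) = cons_cV (f p.1, g p.1 p.2) by case: p.
apply: (scales_cons TF); apply: scales_prod1 => //.
exact: measurable_conj TF.
Qed.

Lemma scales_cons2 (f : 'cV[R]_n -> R -> R) (g : 'cV[R]_n -> 'cV[R]_n) k l :
  (forall x v, T (cons_cV (x, v)) = cons_cV (f v x, g v)) ->
  scales (leb n) g l -> 0 <= k ->
  (forall v, scales (@lebesgue_measure R) (f v) k) ->
  scales (leb n.+1) T (k * l).
Proof.
move=> TE sf l0 sg.
have TF p : T (cons_cV p) = cons_cV (f p.2 p.1, g p.2) by case: p.
apply: (scales_cons TF); apply: scales_prod2 => //.
exact: measurable_conj TF.
Qed.

End scales_cons.

Lemma scales_id d (T : measurableType d) (m : {measure set T -> \bar R}) :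
  scales m id 1.
Proof. by split => // B _; rewrite mul1e. Qed.

Lemma scales_translation n (b : 'cV[R]_n) : scales (leb n) (fun x => x + b) 1.
Proof.
elim: n b => [|n IH] b.
  rewrite (_ : (fun _ => _) = id); first exact: scales_id.
  by apply/funext => x; apply/matrixP => -[].
rewrite -[1](mul1r 1).
apply: (@scales_cons1 n _ _ (fun x => x + b 0 0)
  (fun _ v => v + (uncons_cV b).2)) => //.
- by apply: measurable_fun_addcV => //; exact: measurable_id.
- move=> x v; rewrite -[in LHS](uncons_cVK b) /cons_cV/=.
  by rewrite [LHS](@add_col_mx _ 1 n 1) -raddfD.
- rewrite -[X in scales _ _ X]invr1 -[X in X^-1]normr1.
  rewrite (_ : (fun x => x + b 0 0) = (fun x => 1 * x + b 0 0)).
    exact: scales_affine.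
  by apply/funext => x; rewrite mul1r.
Qed.

Lemma mulmx_ublock_cons n (a : 'M[R]_1) (b : 'rV[R]_n) (D : 'M[R]_n) x v :
  (block_mx a b 0 D : 'M[R]_n.+1) *m cons_cV (x, v) =
  cons_cV (a 0 0 * x + (b *m v) 0 0, D *m v).
Proof.
rewrite /cons_cV/= (@mul_block_col _ 1 n 1 n 1) mul0mx add0r.
congr (@col_mx R 1 n 1 _ _).
apply/matrixP => i j; rewrite !ord1 mxE [in LHS]mul_mx_scalar !mxE mulr1n.
by rewrite mulrC.
Qed.

Lemma mulmx_lblock_cons n (c : 'cV[R]_n) x v :
  (block_mx 1%:M 0 c 1%:M : 'M[R]_n.+1) *m cons_cV (x, v) =
  cons_cV (x, v + x *: c).
Proof.
rewrite /cons_cV/= (@mul_block_col _ 1 n 1 n 1) mul0mx addr0 !mul1mx.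
by rewrite mul_mx_scalar addrC.
Qed.

(** With the last coordinates fixed, the map is affine in the first one. *)
Lemma scales_ublock n (a : 'M[R]_1) (b : 'rV[R]_n) (D : 'M[R]_n) k :
  a 0 0 != 0 -> scales (leb n) (fun v => D *m v) k ->
  scales (leb n.+1) (fun x => (block_mx a b 0 D : 'M[R]_n.+1) *m x)
    (`|a 0 0|^-1 * k).
Proof.
move=> a0 sD; apply: (@scales_cons2 n _ _
  (fun v x => a 0 0 * x + (b *m v) 0 0) (fun v => D *m v)) => //.
- exact: measurable_fun_linmap.
- by move=> x v; rewrite mulmx_ublock_cons.
- by move=> v; exact: scales_affine.
Qed.

Lemma scales_lblock n (c : 'cV[R]_n) :
  scales (leb n.+1) (fun x => (block_mx 1%:M 0 c 1%:M : 'M[R]_n.+1) *m x) 1.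
Proof.
rewrite -[X in scales _ _ X](mul1r 1).
apply: (@scales_cons1 n _ _ id (fun x v => v + x *: c)) => //.
- exact: measurable_fun_linmap.
- by move=> x v; rewrite mulmx_lblock_cons.
- exact: scales_id.
- by move=> x; exact: scales_translation.
Qed.

Lemma scales_mulmx n (A B : 'M[R]_n) k l :
  scales (leb n) (fun x => A *m x) k -> scales (leb n) (fun x => B *m x) l ->
  scales (leb n) (fun x => (A *m B) *m x) (l * k).
Proof.
move=> sA sB; rewrite (_ : (fun x => _) = (fun x => A *m x) \o (fun x => B *m x)).
  exact: scales_comp.
by apply/funext => x /=; rewrite mulmxA.
Qed.

(** The change of variables formula, by induction on the dimension: one step of
block Gaussian elimination writes the matrix as a product of shears and a block
triangular matrix, and [scales] is multiplicative. *)
Lemma scales_linear n (A : 'M[R]_n) : \det A != 0 ->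
  scales (leb n) (fun x => A *m x) `|\det A|^-1.
Proof.
elim: n A => [|n IH] A.
  rewrite det_mx00 normr1 invr1 => _.
  rewrite (_ : (fun _ => _) = id); first exact: scales_id.
  by apply/funext => x; apply/matrixP => -[].
have pivot (B : 'M[R]_n.+1) : \det B != 0 -> B 0 0 != 0 ->
    scales (leb n.+1) (fun x => B *m x) `|\det B|^-1.
  rewrite -[B](@submxK _ 1 n 1 n).
  set a := ulsubmx _; set b := ursubmx _; set c := dlsubmx _; set d := drsubmx _.
  have -> : (block_mx a b c d : 'M[R]_n.+1) 0 0 = a 0 0.
    rewrite -(@block_mxEul _ 1 n 1 n a b c d).
    by congr (fun_of_matrix _ _ _); exact/val_inj.
  move=> dB.
  move=> a0; pose s := a 0 0; pose D := d - s^-1 *: (c *m b).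
  have fact : block_mx a b c d = block_mx 1%:M 0 (s^-1 *: c) 1%:M *m block_mx a b 0 D.
    rewrite mulmx_block !mul1mx !mul0mx !addr0 /D.
    rewrite [X in _ = block_mx _ _ _ X]addrC -!scalemxAl subrK.
    congr (@block_mx R 1 n 1 n _ _ _ _).
    by rewrite [a]mx11_scalar mul_mx_scalar scalerA mulVf ?scale1r.
  move: dB; rewrite fact det_mulmx (@det_lblock _ 1 n) !det1 mul1r mul1r.
  rewrite (@det_ublock _ 1 n) det_mx11.
  rewrite mulf_eq0 negb_or => /andP[_ dD].
  rewrite -[X in scales _ _ X]mulr1 normrM invfM.
  apply: scales_mulmx; first exact: scales_lblock.
  by apply: scales_ublock => //; exact: IH.
move=> dA; have [A00|A00] := eqVneq (A 0 0) 0; last exact: pivot.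
(* Adding a lower row to the first one, a shear of determinant 1, makes a pivot. *)
have [i Ai0] : exists i, A i 0 != 0.
  apply/existsP; rewrite -negb_forall; apply: contra dA => /forallP A0.
  by rewrite (expand_det_col _ 0) big1// => i _; rewrite (eqP (A0 i)) mul0r.
have [j ij] : exists j : 'I_n, i = rshift 1 j.
  case: (@split_ordP 1 n i) => k ik; last by exists k.
  move: Ai0; rewrite (_ : i = 0) ?A00 ?eqxx//; apply/val_inj; rewrite ik/= ord1//.
pose S (e : R) : 'M[R]_n.+1 :=
    block_mx (1%:M : 'M[R]_1) (e *: delta_mx 0 j) 0 1%:M.
have dS e : \det (S e) = 1 by rewrite /S (@det_ublock _ 1 n) !det1 mulr1.
have sS e : scales (leb n.+1) (fun x => S e *m x) 1.
  rewrite -[X in scales _ _ X](mul1r 1) -[X in X * _]invr1 -[X in X^-1 * _]normr1.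
  rewrite [X in `|X|](_ : _ = (1%:M : 'M[R]_1) 0 0); last by rewrite mxE.
  apply: scales_ublock; first by rewrite mxE oner_eq0.
  rewrite (_ : (fun v => _) = id); first exact: scales_id.
  by apply/funext => x; rewrite mul1mx.
have SK : S (-1) *m S 1 = 1%:M.
  rewrite /S [LHS](@mulmx_block _ 1 n 1 n 1 n) !mulmx1 !mul1mx !mulmx0 !mul0mx !add0r !addr0.
  by rewrite -scalerDl subrr scale0r -scalar_mx_block.
rewrite -[A]mul1mx -SK -mulmxA det_mulmx dS mul1r -[X in scales _ _ X]mulr1.
apply: scales_mulmx => //; apply: pivot; first by rewrite det_mulmx dS mul1r.
have -> : S 1 *m A = @col_mx _ 1 n n.+1
    (@usubmx _ 1 n _ A + delta_mx 0 j *m @dsubmx _ 1 n _ A) (@dsubmx _ 1 n _ A).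
  rewrite /S scale1r -[in LHS](@vsubmxK _ 1 n n.+1 A).
  by rewrite [LHS](@mul_block_col _ 1 n 1 n n.+1) !mul1mx mul0mx add0r.
rewrite [X in fun_of_matrix _ X _](_ : 0 = lshift n (0 : 'I_1)); last exact/val_inj.
rewrite (@col_mxEu _ 1 n) mxE -rowE !mxE -ij.
rewrite (_ : lshift n 0 = 0) ?A00 ?add0r//; exact/val_inj.
Qed.

Lemma scales_opp n : scales (leb n) -%R 1.
Proof.
rewrite (_ : -%R = (fun x => (-1)%:M *m x)); last first.
  by apply/funext => x; rewrite mul_scalar_mx scaleN1r.
rewrite [X in scales _ _ X](_ : _ = `|\det ((-1)%:M : 'M[R]_n)|^-1); last first.
  by rewrite det_scalar normrX normrN1 expr1n invr1.
by apply: scales_linear; rewrite det_scalar signr_eq0.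
Qed.

Definition cube n (M : R) := [set x : 'cV[R]_n | forall i, `|x i 0| <= M].
Arguments cube : clear implicits.

Lemma cubeE n M : cube n M = \bigcap_(i in [set: 'I_n])
  ((fun x : 'cV[R]_n => x i 0) @^-1` `[- M, M]).
Proof.
apply/seteqP; split => x /=; first by move=> xM i _ /=; rewrite in_itv/= -ler_norml.
by move=> xM i; have := xM i Logic.I; rewrite /= in_itv/= -ler_norml.
Qed.

Lemma measurable_cube n M : measurable (cube n M).
Proof.
rewrite cubeE; apply: fin_bigcap_measurable; first exact: finite_finset.
move=> i _; rewrite -[X in measurable X]setTI.
by apply: measurable_mx_coord => //; exact: measurable_itv.
Qed.

Lemma lebesgue_cV_cube_lty n M : (leb n (cube n M) < +oo)%E.
Proof.
elim: n => [|n IH].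
  by rewrite /lebesgue_cV/= diracE; case: (_ \in _); rewrite ltry.
rewrite lebesgue_cVS.
rewrite (_ : _ @^-1` _ = `[- M, M] `*` cube n M).
  rewrite product_measure1E//; last exact: measurable_cube.
  apply: lte_mul_pinfty => //.
  rewrite ge0_fin_numE//; have /= -> := lebesgue_measure_itv `[- M, M].
  by case: ifP => _; rewrite ltry.
apply/seteqP; split => -[x v] /=.
  move=> xM; split => [|i].
    rewrite in_itv/= -ler_norml; have := xM (lshift n (0 : 'I_1)).
    by rewrite /cons_cV (@col_mxEu _ 1 n) mxE mulr1n.
  by have := xM (rshift 1 i); rewrite /cons_cV (@col_mxEd _ 1 n).
move=> [xM vM] i; case: (@split_ordP 1 n i) => k ->; last by rewrite /cons_cV (@col_mxEd _ 1 n).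
by rewrite /cons_cV (@col_mxEu _ 1 n) !ord1 mxE mulr1n ler_norml; rewrite in_itv/= in xM.
Qed.

(** An open set is the countable union of the cubes with rational centres and
radii [1 / k] that it contains. *)
Lemma open_measurable_cV n (U : set 'cV[R]_n) : open U -> measurable U.
Proof.
move=> oU.
pose Q : Type := ('cV[rat]_n * nat)%type.
pose r (q : Q) : R := q.2.+1%:R^-1.
pose B (q : Q) := [set x : 'cV[R]_n | forall i, `|x i 0 - ratr (q.1 i 0)| < r q].
have mB q : measurable (B q).
  rewrite (_ : B q = \bigcap_(i in [set: 'I_n])
      ((fun x : 'cV[R]_n => x i 0) @^-1` `]ratr (q.1 i 0) - r q, ratr (q.1 i 0) + r q[)).
    apply: fin_bigcap_measurable; first exact: finite_finset.
    move=> i _; rewrite -[X in measurable X]setTI.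
    by apply: measurable_mx_coord => //; exact: measurable_itv.
  apply/seteqP; split => x /=.
    by move=> xM i _ /=; rewrite in_itv/= -ltr_distl.
  by move=> xM i; have := xM i Logic.I; rewrite /= in_itv/= -ltr_distl.
rewrite (_ : U = \bigcup_(q : Q) (if `[< B q `<=` U >] then B q else set0)); last first.
  apply/seteqP; split => [x Ux|x [q _]]; last by case: asboolP => // BU /BU.
  have /nbhs_ballP[e /= e0 eU] : nbhs x U by exact: open_nbhs_nbhs.
  pose k := Num.truncn (2 / e).
  have k0 : (0 : R) < k.+1%:R by [].
  have ke : 2 * k.+1%:R^-1 < e.
    by rewrite ltr_pdivrMr// mulrC -ltr_pdivrMr// /k truncnS_gt.
  have /choice[q qP] (i : 'I_n) : exists q : rat, `|x i 0 - ratr q| < k.+1%:R^-1.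
    have [|q] := @rat_in_itvoo R (x i 0 - k.+1%:R^-1) (x i 0 + k.+1%:R^-1).
      by rewrite ltrD2l gtrN ?invr_gt0.
    by rewrite in_itv/= -ltr_distl distrC; exists q.
  exists ((\col_i q i, k) : Q) => //; case: asboolP => [_ i|]; first by rewrite mxE.
  case=> y yB; apply: eU; split => // i j; rewrite ord1 /ball/=.
  apply: le_lt_trans ke; rewrite mulr_natl mulr2n.
  apply: le_trans (ler_distD (ratr (q i)) _ _) _; rewrite lerD ?ltW//.
  by have := yB i; rewrite mxE distrC.
apply: countable_bigcupT_measurable; first exact: countableP.
by move=> q; case: ifP.
Qed.

Lemma continuous_measurable_cV n (f : 'cV[R]_n -> R) :
  continuous f -> measurable_fun setT f.
Proof.
move=> cf; apply: (measurability _ (RGenOpens.measurableE R)).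
move=> _ [_ [a [b ->]] <-]; rewrite setTI; apply: open_measurable_cV.
by apply: open_comp => // x _; exact: cf.
Qed.

End lebesgue_linear.
Arguments cube {R} n M.

(** * The matrix exponential *)

Section matrix_derivative.
Context {R : realType}.

(** Entrywise, so that the differentiation rules of real functions apply. *)
Definition mx_derive m n (F : R -> 'M[R]_(m, n)) (t : R) (D : 'M[R]_(m, n)) :=
  forall i j, is_derive t (1 : R) (fun t => F t i j) (D i j).

Lemma is_derive_bigsum I (r : seq I) (f : I -> R -> R) (f' : I -> R) (t : R) :
  (forall i, is_derive t (1 : R) (f i) (f' i)) ->
  is_derive t (1 : R) (fun t => \sum_(i <- r) f i t) (\sum_(i <- r) f' i).
Proof.
move=> df; elim: r => [|i r IH].
  rewrite big_nil (_ : (fun _ => _) = cst 0); first exact: is_derive_cst.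
  by apply/funext => x; rewrite big_nil.
rewrite big_cons (_ : (fun _ => _) = f i + (fun t => \sum_(i <- r) f i t)).
  exact: is_deriveD.
by apply/funext => x; rewrite big_cons.
Qed.

Lemma mx_derive_mul m n p (F : R -> 'M[R]_(m, n)) (G : R -> 'M[R]_(n, p))
    (t : R) F' G' : mx_derive F t F' -> mx_derive G t G' ->
  mx_derive (fun t => F t *m G t) t (F' *m G t + F t *m G').
Proof.
move=> dF dG i j.
rewrite (_ : (fun _ => _) = (fun t => \sum_k F t i k * G t k j)); last first.
  by apply/funext => x; rewrite mxE.
rewrite !mxE -big_split/=; apply: is_derive_bigsum => k.
apply: (@is_derive_eq _ _ _ ((fun t => F t i k) * (fun t => G t k j)) _ _ _ _
  (is_deriveM (dF i k) (dG k j))).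
by rewrite /GRing.scale/= [LHS]addrC; congr (_ + _); exact: mulrC.
Qed.

Lemma mx_derive0_cst m n (F : R -> 'M[R]_(m, n)) s t :
  (forall x, mx_derive F x 0) -> F s = F t.
Proof.
move=> dF; apply/matrixP => i j.
apply: (@is_derive_0_is_cst _ (fun t => F t i j)) => x.
by have := dF x i j; rewrite mxE.
Qed.

(** Leibniz' rule, by recursion on the list of factors. *)
Fixpoint prod_derive I (r : seq I) (f f' : I -> R) : R :=
  if r is i :: r' then
    f' i * \prod_(j <- r') f j + f i * prod_derive r' f f'
  else 0.

Lemma is_derive_bigprod I (r : seq I) (f : I -> R -> R) (f' : I -> R) (t : R) :
  (forall i, is_derive t (1 : R) (f i) (f' i)) ->
  is_derive t (1 : R) (fun t => \prod_(i <- r) f i t)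
    (prod_derive r (fun i => f i t) f').
Proof.
move=> df; elim: r => [|i r IH] /=.
  rewrite (_ : (fun _ => _) = cst 1); first exact: is_derive_cst.
  by apply/funext => x; rewrite big_nil.
rewrite (_ : (fun _ => _) = f i * (fun t => \prod_(i <- r) f i t)); last first.
  by apply/funext => x; rewrite big_cons.
apply: (is_derive_eq (is_deriveM (df i) IH)).
by rewrite /GRing.scale/= addrC [in LHS]mulrC.
Qed.

Lemma prod_derive1 I (r : seq I) (f f' : I -> R) : (forall i, f i = 1) ->
  prod_derive r f f' = \sum_(i <- r) f' i.
Proof.
move=> f1; elim: r => [|i r /= ->]; first by rewrite big_nil.
by rewrite big_cons big1 ?f1 ?mul1r ?mulr1.
Qed.

Lemma prod_derive0 I (r : seq I) (f f' : I -> R) :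
  (1 < count (fun i => f i == 0%R) r)%N -> prod_derive r f f' = 0.
Proof.
have prod0 (s : seq I) : (0 < count (fun i => f i == 0%R) s)%N ->
    \prod_(i <- s) f i = 0.
  elim: s => // i s IH /=; rewrite big_cons.
  by case: eqVneq => [->|_ /IH ->]; rewrite ?mul0r ?mulr0.
elim: r => // i r IH /=; case: eqVneq => [fi0|_] /=.
  by rewrite add1n ltnS => /prod0 ->; rewrite fi0 mulr0 mul0r addr0.
rewrite add0n => r1; rewrite prod0 ?IH ?mulr0 ?addr0//.
exact: ltn_trans r1.
Qed.

(** In the expansion of the determinant over permutations, every permutation
other than the identity has at least two factors off the diagonal. They vanish
at [t], so its term has derivative 0, and the identity contributes the trace. *)
Lemma is_derive_det n (F : R -> 'M[R]_n) t D : F t = 1%:M ->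
  mx_derive F t D -> is_derive t (1 : R) (fun t => \det (F t)) (\tr D).
Proof.
move=> F1 dF.
rewrite (_ : \tr D = \sum_(s : 'S_n) (-1) ^+ s *
    prod_derive (index_enum 'I_n) (fun i => F t i (s i)) (fun i => D i (s i))).
  apply: is_derive_bigsum => s.
  pose g (i : 'I_n) t := F t i (s i).
  have dg i : is_derive t (1 : R) (g i) (D i (s i)) by exact: dF.
  exact: (is_deriveZ ((-1) ^+ s) (is_derive_bigprod (index_enum 'I_n) dg)).
rewrite (bigD1 1%g)//= big1 ?addr0.
  rewrite odd_perm1 expr0 mul1r prod_derive1.
    by apply: eq_bigr => i _; rewrite perm1.
  by move=> i; rewrite perm1 F1 mxE eqxx.
move=> s s1; rewrite prod_derive0 ?mulr0//.
have [i si] : exists i, s i != i.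
  apply/existsP; rewrite -negb_forall; apply: contra s1 => /forallP s1.
  by apply/eqP/permP => i; rewrite perm1; apply/eqP.
rewrite (_ : count _ _ = #|[pred i | s i != i]|); last first.
  rewrite -sum1_card -sum1_count; apply: eq_bigl => j.
  by rewrite F1 mxE inE (eq_sym (s j)) pnatr_eq0 eqb0.
by apply/card_gt1P; exists i, (s i); rewrite !inE si (inj_eq perm_inj) si eq_sym.
Qed.

End matrix_derivative.

Section matrix_exponential.
Context {R : realType} {d : nat}.
Variable E : 'M[R]_d.

(** The coefficients of the power series of the [m]-th derivative of the entry
[(i, j)] of [exp (t E)]: differentiating term by term increments [m]. *)
Definition exp_entry m i j : nat -> R :=
  fun k => (E ^+ (k + m)) i j / k`!%:R.

Definition expt t : 'M[R]_d := \matrix_(i, j) limn (pseries (exp_entry 0 i j) t).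

Lemma pseries_diffs_exp_entry m i j :
  pseries_diffs (exp_entry m i j) = exp_entry m.+1 i j.
Proof.
apply/funext => k; rewrite /pseries_diffs /exp_entry addSnnS factS natrM invfM.
by rewrite mulrCA mulVKf ?pnatr_eq0.
Qed.

(** The entries of [E^k] are at most [M^k], which leaves the exponential series of
[M |t|]. *)
Lemma is_cvg_exp_entry m i j t : cvgn (pseries (exp_entry m i j) t).
Proof.
pose M : R := 1 + \sum_i \sum_j `|E i j|.
have M1 : 1 <= M by rewrite lerDl sumr_ge0// => ? _; rewrite sumr_ge0.
have M0 : 0 <= M by rewrite (le_trans _ M1).
have EM k i' : `|(E ^+ k) i' j| <= M ^+ k.
  elim: k i' => [|k IH] i'.
    by rewrite !expr0 mxE; case: (_ == _); rewrite ?normr1 ?normr0.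
  rewrite exprS mxE; apply: le_trans (ler_norm_sum _ _ _) _.
  apply: (@le_trans _ _ (\sum_l `|E i' l| * M ^+ k)).
    by apply: ler_sum => l _; rewrite normrM ler_wpM2l.
  rewrite -mulr_suml exprS ler_wpM2r ?exprn_ge0// ler_wpDl//.
  by rewrite [leRHS](bigD1 i')//= lerDl sumr_ge0// => ? _; rewrite sumr_ge0.
apply: normed_cvg.
apply: (@series_le_cvg _ _ (M ^+ m *: exp_coeff (M * `|t|))) => [k|k|k|].
- exact: normr_ge0.
- by rewrite /GRing.scale/= /exp_coeff/= mulr_ge0 ?exprn_ge0// exp_coeff_ge0// mulr_ge0.
- have -> : (M ^+ m *: exp_coeff (M * `|t|)) k =
      M ^+ (k + m) / k`!%:R * `|t| ^+ k.
    rewrite -[LHS]/(M ^+ m * ((M * `|t|) ^+ k / k`!%:R)) exprMn exprD.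
    ring.
  rewrite /exp_entry/= !normrM normrX [X in _ * X * _]ger0_norm ?invr_ge0//.
  by rewrite ler_wpM2r ?exprn_ge0// ler_wpM2r ?invr_ge0.
- exact/is_cvg_seriesZ/is_cvg_series_exp_coeff.
Qed.

Lemma exptE i j t : expt t i j = limn (pseries (exp_entry 0 i j) t).
Proof. by rewrite mxE. Qed.

Lemma scalemx_exp t k : (t *: E) ^+ k = t ^+ k *: E ^+ k.
Proof.
elim: k => [|k IH]; first by rewrite !expr0 scale1r.
by rewrite !exprS IH -[LHS]scalemxAl -scalemxAr scalerA.
Qed.

Lemma expmxZE t : expmx (t *: E) = expt t.
Proof.
apply: cvg_lim; first exact: norm_hausdorff.
apply/cvgrPdist_lt => e e0.
have cvgE i j : series (fun k => exp_entry 0 i j k * t ^+ k) @ \oo --> expt t i j.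
  by rewrite exptE; exact: is_cvg_exp_entry.
have {cvgE} near_entry i j : \forall n \near \oo,
    `|expt t i j - series (fun k => exp_entry 0 i j k * t ^+ k) n| < e.
  by have /cvgrPdist_lt/(_ _ e0) := cvgE i j.
have : \forall n \near \oo, forall i, forall j,
    `|expt t i j - series (fun k => exp_entry 0 i j k * t ^+ k) n| < e.
  by apply: filter_forall => i; apply: filter_forall => j; exact: near_entry.
apply: filterS => n ne.
rewrite -[X in X < _]/(mx_norm _) mx_normrE.
apply/bigmax_ltP; split => // -[i j] _ /=.
rewrite !mxE summxE; have := ne i j; rewrite mxE /series/=.
congr (`|_ - _| < _); apply: eq_bigr => k _.
rewrite mxE /exp_entry addn0 scalemx_exp mxE.
by ring.
Qed.

Lemma expt_derive t : mx_derive expt t (E *m expt t).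
Proof.
move=> i j.
rewrite (_ : (fun t => _) = (fun x => limn (pseries (exp_entry 0 i j) x))); last first.
  by apply/funext => x; rewrite exptE.
have := @pseries_snd_diffs R (exp_entry 0 i j) (`|t| + 1) t.
rewrite !pseries_diffs_exp_entry => /(_ _ _ _ _)/is_derive_eq; apply.
- exact: is_cvg_exp_entry.
- exact: is_cvg_exp_entry.
- exact: is_cvg_exp_entry.
- by rewrite [ltRHS]ger0_norm ?addr_ge0// ltrDl.
rewrite mxE; under eq_bigr do rewrite exptE.
apply: cvg_lim => //.
have -> : pseries (exp_entry 1 i j) t =
    (fun n => \sum_l E i l * pseries (exp_entry 0 l j) t n).
  apply/funext => n; rewrite /pseries /series/=.
  under [RHS]eq_bigr do rewrite mulr_sumr.
  rewrite exchange_big/=; apply: eq_bigr => k _.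
  rewrite /exp_entry addn1 addn0 exprS mxE -!mulrA mulr_suml.
  by apply: eq_bigr => l _; rewrite !mulrA.
apply: cvg_big => [|l _]; [exact: add_continuous|apply: cvgMr; exact: is_cvg_exp_entry].
Qed.

Lemma expt0 : expt 0 = 1%:M.
Proof.
apply/matrixP => i j; rewrite exptE; apply: cvg_lim => //.
rewrite -(cvg_shiftn 1)/=.
rewrite (_ : (fun n => _) = cst ((1%:M : 'M[R]_d) i j)); first exact: cvg_cst.
apply/funext => n; rewrite /pseries /series/= addn1 big_nat_recl// big1 ?addr0.
  by rewrite /exp_entry addn0 expr0 fact0 divr1 mulr1.
by move=> k _; rewrite expr0n mulr0.
Qed.

Lemma comm_exptE t : E *m expt t = expt t *m E.
Proof.
apply/matrixP => i j; rewrite !mxE.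
under eq_bigr do rewrite exptE.
under [RHS]eq_bigr do rewrite exptE.
have c1 : (fun n => \sum_l E i l * pseries (exp_entry 0 l j) t n) @ \oo -->
    \sum_l E i l * limn (pseries (exp_entry 0 l j) t).
  by apply: cvg_big => [|l _]; [exact: add_continuous|apply: cvgMr; exact: is_cvg_exp_entry].
have c2 : (fun n => \sum_l pseries (exp_entry 0 i l) t n * E l j) @ \oo -->
    \sum_l limn (pseries (exp_entry 0 i l) t) * E l j.
  by apply: cvg_big => [|l _]; [exact: add_continuous|apply: cvgMl; exact: is_cvg_exp_entry].
suff fE : (fun n => \sum_l E i l * pseries (exp_entry 0 l j) t n) =
    (fun n => \sum_l pseries (exp_entry 0 i l) t n * E l j).
  by rewrite fE in c1; exact: (cvg_unique _ c1 c2).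
apply/funext => n; rewrite /pseries /series/=.
under eq_bigr do rewrite mulr_sumr.
under [RHS]eq_bigr do rewrite mulr_suml.
rewrite exchange_big/= [RHS]exchange_big/=; apply: eq_bigr => k _.
have := congr1 (fun M : 'M[R]_d => M i j) (exprSr E k); rewrite exprS !mxE => EE.
rewrite /exp_entry addn0.
transitivity ((\sum_l E i l * (E ^+ k) l j) * (k`!%:R^-1 * t ^+ k)).
  by rewrite mulr_suml; apply: eq_bigr => l _; rewrite -!mulrA.
by rewrite EE mulr_suml; apply: eq_bigr => l _; ring.
Qed.

Lemma mx_derive_exptN t : mx_derive (fun t => expt (- t)) t (- (E *m expt (- t))).
Proof.
move=> i j; have := is_derive1_comp (expt_derive (- t) i j) (is_deriveNid t 1).
by move=> /is_derive_eq; apply; rewrite [RHS]mxE mulrN1.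
Qed.

Lemma mx_derive_expt_shift s t :
  mx_derive (fun t => expt (t + s)) t (E *m expt (t + s)).
Proof.
move=> i j; have := @is_derive1_comp _ (fun u => expt u i j) (shift s) t _ _
  (expt_derive (t + s) i j) (is_derive_shift t 1 s).
by move=> /is_derive_eq; apply; rewrite mulr1.
Qed.

(** The left side has derivative 0 in [t], and the value at [t = 0] is the right
side. The addition formula follows. *)
Lemma exptN_mul s t : expt (- t) *m expt (t + s) = expt s.
Proof.
rewrite (@mx_derive0_cst _ _ _ (fun t => expt (- t) *m expt (t + s)) t 0).
  by rewrite oppr0 add0r expt0 mul1mx.
move=> x; have := mx_derive_mul (mx_derive_exptN x) (mx_derive_expt_shift s x).
by rewrite mulNmx comm_exptE -mulmxA addNr.
Qed.

Lemma exptK t : expt (- t) *m expt t = 1%:M.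
Proof. by have := exptN_mul 0 t; rewrite addr0 expt0. Qed.

Lemma exptD s t : expt (s + t) = expt s *m expt t.
Proof.
by rewrite -[X in _ = _ *m X](exptN_mul t s) mulmxA (mulmx1C (exptK s)) mul1mx.
Qed.

(** By the addition formula and the derivative of the determinant at the
identity, [det (exp (t E))] solves [y' = (tr E) y] with [y 0 = 1]. *)
Lemma det_expt t : \det (expt t) = expR (t * \tr E).
Proof.
have dg0 : is_derive (0 : R) (1 : R) (fun t => \det (expt t)) (\tr E).
  by apply: is_derive_det; rewrite ?expt0//; have := expt_derive 0; rewrite expt0 mulmx1.
have dg x : is_derive x (1 : R) (fun t => \det (expt t)) (\det (expt x) * \tr E).
  rewrite (_ : (fun t => _) =
    (\det (expt x) \*: ((fun t => \det (expt t)) \o shift (- x)))); last first.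
    by apply/funext => y /=; rewrite /GRing.scale/= -det_mulmx -exptD addrC subrK.
  apply: is_deriveZ; rewrite -[X in is_derive _ _ _ X]mulr1.
  by apply: is_derive1_comp; [rewrite /shift/= subrr|exact: is_derive_shift].
have de x : is_derive x (1 : R) (fun t => expR (- \tr E * t)) (expR (- \tr E * x) * - \tr E).
  apply: is_derive1_comp.
  apply: (is_derive_eq (is_deriveZ (- \tr E) (is_derive_id x (1 : R)))).
  by rewrite /GRing.scale/= mulr1.
pose F t := \det (expt t) * expR (- \tr E * t).
have Ft : F t = F 0.
  apply: is_derive_0_is_cst => x; apply: (is_derive_eq (is_deriveM (dg x) (de x))).
  rewrite /GRing.scale/=; ring.
have H : \det (expt t) * expR (- \tr E * t) = 1.
  by rewrite -/(F t) Ft /F expt0 det1 mulr0 expR0 mulr1.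
rewrite -[LHS]mulr1 -(expR0 R) -(addNr (\tr E * t)) expRD mulrA -mulNr H mul1r.
by rewrite mulrC.
Qed.

End matrix_exponential.

Section powmx.
Context {R : realType} {d : nat}.
Variable E : 'M[R]_d.

Lemma powmx1 : powmx 1 E = 1%:M.
Proof. by rewrite /powmx ln1 expmxZE expt0. Qed.

Lemma powmxM a b : 0 < a -> 0 < b -> powmx (a * b) E = powmx a E *m powmx b E.
Proof. by move=> a0 b0; rewrite /powmx !expmxZE lnM ?posrE// exptD. Qed.

Lemma powmxVK a : 0 < a -> powmx a E *m powmx a^-1 E = 1%:M.
Proof.
by move=> a0; rewrite -powmxM ?invr_gt0// mulfV ?powmx1// gt_eqF.
Qed.

Lemma det_powmx c : 0 < c -> \det (powmx c E) = c `^ (\tr E).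
Proof.
by move=> c0; rewrite /powmx expmxZE det_expt /powR gt_eqF// mulrC.
Qed.

End powmx.

(** * Compactness and norms on column vectors *)

Section euclidean_compactness.
Context {R : realType}.

Lemma entry_le_norm m n (x : 'M[R]_(m, n)) i j : `|x i j| <= `|x|.
Proof.
rewrite -[leRHS]/(mx_norm x) mx_normrE.
exact: (@le_bigmax _ _ _ 0 (fun ij : 'I_m * 'I_n => `|x ij.1 ij.2|) (i, j)).
Qed.

Lemma norm_le_entries m n (x : 'M[R]_(m, n)) M : 0 <= M ->
  (forall i j, `|x i j| <= M) -> `|x| <= M.
Proof.
move=> M0 xM; rewrite -[leLHS]/(mx_norm x) mx_normrE.
by apply/bigmax_leP; split => // -[i j] _ /=.
Qed.

Lemma cubeP n (M : R) x : 0 <= M -> cube n M x <-> `|x| <= M.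
Proof.
move=> M0; split => [xM|xM i]; last exact: le_trans (entry_le_norm _ _ _) xM.
by apply: norm_le_entries => // i j; rewrite ord1.
Qed.

Lemma near_dist_lt m n (x : 'M[R]_(m, n)) e : 0 < e ->
  \forall y \near x, `|x - y| < e.
Proof. by move=> e0; apply/nbhs_ballP; exists e => // y; rewrite mx_norm_ball. Qed.

Lemma trmx_continuous m n : continuous (@trmx R m n).
Proof.
move=> x; apply/(@cvgrPdist_lt _ _ _ (nbhs x)) => e e0.
apply: (@filterS _ (nbhs x) _ _ _ _ (near_dist_lt x e0)) => y xy.
rewrite -linearB/= (le_lt_trans (y := `|x - y|))//.
  apply: norm_le_entries => // i j; rewrite mxE.
  exact: entry_le_norm.
Qed.

Lemma closed_cube n (M : R) : closed (cube n M).
Proof.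
rewrite cubeE; apply: closed_bigI => i _; apply: closed_comp => [x _|].
  exact: coord_continuous.
exact: interval_closed.
Qed.

(** The Heine-Borel theorem for row vectors, carried over by transposition. *)
Lemma compact_cube n (M : R) : compact (cube n M).
Proof.
rewrite (_ : cube n M = trmx @` [set v : 'rV[R]_n | cube n M v^T]).
  apply: continuous_compact.
    by apply: continuous_subspaceT => x; exact: trmx_continuous.
  apply: bounded_closed_compact.
    exists `|M|; split; first exact: num_real.
    move=> r Mr v /= vM; apply: norm_le_entries.
      by rewrite (le_trans _ (ltW Mr)).
    move=> i j; rewrite ord1; have := vM j; rewrite mxE => /le_trans; apply.
    by rewrite (le_trans (ler_norm _))// ltW.
  by apply: closed_comp => [x _|]; [exact: trmx_continuous|exact: closed_cube].
apply/seteqP; split => [x xM|_ [v vM <-]//].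
by exists x^T; rewrite /= trmxK.
Qed.

Lemma norm_mulmx_le m n (A : 'M[R]_(m, n)) (x : 'cV[R]_n) :
  `|A *m x| <= (\sum_i \sum_j `|A i j|) * `|x|.
Proof.
have S0 : 0 <= \sum_i \sum_j `|A i j|.
  by rewrite sumr_ge0// => ? _; rewrite sumr_ge0.
apply: norm_le_entries; first exact: mulr_ge0.
move=> i j; rewrite mxE (le_trans (ler_norm_sum _ _ _))//.
apply: (@le_trans _ _ (\sum_k `|A i k| * `|x|)).
  apply: ler_sum => k _; rewrite normrM ler_wpM2l//; exact: entry_le_norm.
rewrite -mulr_suml ler_wpM2r//.
by rewrite [leRHS](bigD1 i)//= lerDl sumr_ge0// => ? _; rewrite sumr_ge0.
Qed.

Lemma entry_le_enorm n (x : 'cV[R]_n) i : `|x i 0| <= enorm x.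
Proof.
rewrite /enorm -sqrtr_sqr ler_wsqrtr// (bigD1 i)//= lerDl.
by apply: sumr_ge0 => j _; exact: sqr_ge0.
Qed.

Lemma enorm_le n (x : 'cV[R]_n) M : 0 <= M -> cube n M x ->
  enorm x <= Num.sqrt (n%:R * M ^+ 2).
Proof.
move=> M0 xM; rewrite /enorm ler_wsqrtr// -[n in n%:R]card_ord -sum1_card.
rewrite natr_sum mulr_suml; apply: ler_sum => i _; rewrite mul1r.
by rewrite -real_normK ?num_real// lerXn2r ?nnegrE.
Qed.

Section norms.
Variables (n : nat) (N : 'cV[R]_n -> R).
Hypothesis hN : is_norm N.

Lemma is_norm0 : N 0 = 0.
Proof.
have [_ _ NZ _] := hN.
by rewrite -(scale0r 0) NZ normr0 mul0r.
Qed.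

(** All norms are equivalent to the maximum norm; here the upper bound, from the
values of [N] on the standard basis, and in [is_norm_ge] the lower one, from the
minimum of [N] on the unit sphere. *)
Lemma is_norm_le : exists2 K, 0 <= K & forall x, N x <= K * `|x|.
Proof.
have [N0 _ NZ ND] := hN.
exists (\sum_(i < n) N (delta_mx i 0)); first by rewrite sumr_ge0.
move=> x; rewrite {1}(_ : x = \sum_i x i 0 *: delta_mx i 0); last first.
  by rewrite [LHS]matrix_sum_delta; apply: eq_bigr => i _; rewrite big_ord1.
rewrite mulr_suml.
apply: (@le_trans _ _ (\sum_i N (x i 0 *: delta_mx i 0))).
  elim/big_ind2 : _ => [|a b a' b' Hb Ha|i _]; rewrite ?is_norm0//.
  by rewrite (le_trans (ND _ _))// lerD.
apply: ler_sum => i _; rewrite NZ mulrC ler_wpM2l//; exact: entry_le_norm.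
Qed.

Lemma is_norm_continuous : continuous N.
Proof.
have [N0 _ NZ ND] := hN; have [K K0 NK] := is_norm_le.
have NB x y : `|N x - N y| <= K * `|x - y|.
  apply: le_trans (NK _); rewrite ler_norml; apply/andP; split.
    have := ND (y - x) x; rewrite subrK lerNl opprB lerBlDr.
    by rewrite -opprB -scaleN1r NZ normrN1 mul1r.
  by rewrite lerBlDr (le_trans _ (ND _ _))// subrK.
move=> x; apply/(@cvgrPdist_lt _ _ _ (nbhs x)) => e e0.
have K1 : 0 < K + 1 by rewrite ltr_wpDl.
have eK : 0 < e / (K + 1) by rewrite divr_gt0.
apply: (@filterS _ (nbhs x) _ _ _ _ (near_dist_lt x eK)) => y xy.
rewrite (le_lt_trans (NB _ _))//.
apply: (@le_lt_trans _ _ ((K + 1) * `|x - y|)); first by rewrite ler_wpM2r// lerDl.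
by rewrite mulrC -ltr_pdivlMr.
Qed.

Lemma is_norm_ge : exists2 c, 0 < c & forall x, c * `|x| <= N x.
Proof.
have [N0 Nx0 NZ ND] := hN.
pose S := [set x : 'cV[R]_n | `|x| = 1].
(* In dimension 0 the unit sphere is empty. *)
have [S0|/set0P S0] := eqVneq S set0.
  exists 1 => // x; have [->|x0] := eqVneq x 0.
    by rewrite normr0 mulr0 N0.
  suff : S (`|x|^-1 *: x) by rewrite S0.
  by rewrite /S/= normrZ normrV ?unitfE ?normr_eq0// normr_id mulVf ?normr_eq0.
have cS : compact S.
  apply: (subclosed_compact _ (@compact_cube n 1)); last first.
    by move=> x; rewrite /S/= => x1; apply/cubeP => //; rewrite x1.
  rewrite (_ : S = (fun x : 'cV[R]_n => `|x|) @^-1` [set 1])//.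
  apply: closed_comp => [x _|]; first exact: norm_continuous.
  exact: closed_eq.
have cN : {within S, continuous N}.
  by apply: continuous_subspaceT; exact: is_norm_continuous.
have [c cS' cP] := compact_EVT_min S0 cS cN.
move/set_mem: cS' => cS'; rewrite /S/= in cS'.
exists (N c).
  rewrite lt_neqAle N0 andbT eq_sym; apply/eqP => /Nx0 c0.
  by move: cS'; rewrite c0 normr0 => /eqP; rewrite eq_sym oner_eq0.
move=> x; have [->|x0] := eqVneq x 0; first by rewrite normr0 mulr0 N0.
have nx0 : 0 < `|x| by rewrite normr_gt0.
rewrite -ler_pdivlMr// mulrC -[X in X * _]ger0_norm ?invr_ge0// -NZ.
apply: cP; apply: mem_set.
by rewrite /S/= normrZ normrV ?unitfE ?normr_eq0// normr_id mulVf ?normr_eq0.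
Qed.

End norms.
End euclidean_compactness.

(** * Homogeneous admissible functions *)

Section polar.
Context {R : realType} {d : nat}.
Variables (E : 'M[R]_d) (N : 'cV[R]_d -> R).
Hypothesis d_gt0 : (0 < d)%N.
Hypothesis hN : adapted_norm E N.

Let N_norm : is_norm N. Proof. by have [] := hN. Qed.

Lemma powmx_mulVK a (x : 'cV[R]_d) : 0 < a -> powmx a E *m (powmx a^-1 E *m x) = x.
Proof. by move=> a0; rewrite mulmxA powmxVK// mul1mx. Qed.

Lemma exists_neq0 : exists x : 'cV[R]_d, x != 0.
Proof.
exists (const_mx 1); apply/eqP => /matrixP/(_ (Ordinal d_gt0) 0).
by rewrite !mxE => /eqP; rewrite oner_eq0.
Qed.

Lemma tauP x : x != 0 -> 0 < tau E N x /\
  exists theta, N theta = 1 /\ x = powmx (tau E N x) E *m theta.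
Proof.
move=> x0; rewrite /tau (negbTE x0).
have [_ [[_ _ surj] _] _] := hN.
have [[r th] /= [r0 Nth] xE] := surj _ x0.
apply: (@xgetPex _ 0 [set r | 0 < r /\ exists theta, N theta = 1 /\ x = powmx r E *m theta]).
by exists r; split => //; exists th.
Qed.

Lemma adapted_norm_mono (s t : R) x : 0 < s -> s <= t ->
  N (powmx s E *m x) <= N (powmx t E *m x).
Proof.
move=> s0; rewrite le_eqVlt => /predU1P[->//|st].
have [->|x0] := eqVneq x 0; first by rewrite !mulmx0.
by have [_ _ mono] := hN; apply/ltW/mono.
Qed.

Definition norm_sphere := [set x : 'cV[R]_d | N x = 1].

Lemma compact_norm_level (r : R) : compact [set x : 'cV[R]_d | N x <= r].
Proof.
have [c c0 cN] := is_norm_ge N_norm.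
apply: (subclosed_compact _ (@compact_cube R d (`|r| / c))); last first.
  move=> x /= xr; apply/cubeP; first by rewrite divr_ge0// ltW.
  by rewrite ler_pdivlMr// mulrC (le_trans (cN _))// (le_trans xr)// ler_norm.
rewrite (_ : [set x | _] = N @^-1` [set y | y <= r])//.
apply: closed_comp; last exact: closed_le.
by move=> x _; exact: is_norm_continuous.
Qed.

Lemma compact_norm_sphere : compact norm_sphere.
Proof.
apply: (subclosed_compact _ (@compact_norm_level 1)); last by move=> x /= ->.
rewrite (_ : norm_sphere = N @^-1` [set y | y = 1])//.
apply: closed_comp; last exact: closed_eq.
by move=> x _; exact: is_norm_continuous.
Qed.

Section homogeneous.
Variables (beta : R) (phi : 'cV[R]_d -> R).
Hypothesis beta_gt0 : 0 < beta.
Hypothesis phi_hom : homogeneous_fun E phi.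
Hypothesis phi_adm : admissible_fun beta E N phi.

Let cphi : continuous phi. Proof. by have [] := phi_adm. Qed.

Let phi_ge0 x : 0 <= phi x. Proof. by have [] := phi_adm. Qed.

Let phi_gt0 x : x != 0 -> 0 < phi x. Proof. by have [_ _ ] := phi_adm => + _; apply. Qed.

(** Otherwise [phi] would be positive everywhere, with a positive minimum on a
compact ball of [N]. But the maps [t^E] with [t <= 1] preserve this ball and make
[phi] as small as one likes. *)
Lemma homogeneous0 : phi 0 = 0.
Proof.
apply/eqP; apply: contraT => phi0.
have {}phi0 : 0 < phi 0 by rewrite lt_neqAle eq_sym phi0 phi_ge0.
have phi_pos x : 0 < phi x by have [->//|/phi_gt0] := eqVneq x 0.
have [x x0] := exists_neq0.
have cK := @compact_norm_level (N x).
have Kx : [set y : 'cV[R]_d | N y <= N x] !=set0 by exists x => /=.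
have cphiK : {within [set y : 'cV[R]_d | N y <= N x], continuous phi}.
  exact: continuous_subspaceT.
have [c _ cP] := compact_EVT_min Kx cK cphiK.
pose t := Num.min 1 (phi c / phi x / 2).
have t0 : 0 < t by rewrite lt_min ltr01/= !divr_gt0.
have : phi c <= phi (powmx t E *m x).
  apply/cP/mem_set => /=.
  rewrite -[X in N X <= _]/(powmx t E *m x) -[X in _ <= N X](mul1mx x) -(powmx1 E).
  by apply: adapted_norm_mono => //; rewrite ge_min lexx.
rewrite phi_hom// leNgt => /negP; case.
rewrite (@le_lt_trans _ _ (phi c / 2))//; last by rewrite gtr_pMr// invf_lt1// ltr1n.
rewrite -ler_pdivlMr// mulrAC ge_min; apply/orP; right.
by rewrite mulrAC.
Qed.

Lemma homogeneousE c x : 0 < c -> phi (powmx c E *m x) = c * phi x.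
Proof.
move=> c0; have [->|x0] := eqVneq x 0; last exact: phi_hom.
by rewrite mulmx0 homogeneous0 mulr0.
Qed.

Lemma admissible_eq0 x : (phi x == 0) = (x == 0).
Proof.
by have [->|/phi_gt0/gt_eqF] := eqVneq x 0; rewrite ?homogeneous0 ?eqxx.
Qed.

(** By homogeneity [phi x = tau x * phi (l x)], so [m] may be the minimum of [phi]
on the unit sphere of [N]. *)
Lemma tau_le : exists2 m, 0 < m & forall x, m * tau E N x <= phi x.
Proof.
have S0 : norm_sphere !=set0.
  have [x /tauP[_ [th [Nth _]]]] := exists_neq0.
  by exists th.
have cphiS : {within norm_sphere, continuous phi} by exact: continuous_subspaceT.
have [c /set_mem/= Nc cP] := compact_EVT_min S0 compact_norm_sphere cphiS.
exists (phi c).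
  apply: phi_gt0; apply: contra_eqN Nc => /eqP ->.
  by rewrite is_norm0// eq_sym oner_eq0.
move=> x; have [->|x0] := eqVneq x 0; first by rewrite /tau eqxx mulr0.
have [t0 [th [Nth xE]]] := tauP x0.
rewrite [leRHS](congr1 phi xE) phi_hom//; last first.
  by apply: contraNneq x0 => th0; rewrite xE th0 mulmx0.
by rewrite mulrC ler_pM2l//; exact/cP/mem_set.
Qed.

(** On [{phi <= s}] the radial part [tau] is at most [s / m] by [tau_le], and by
monotonicity [N x] is at most its value at [(s / m)^E l x], where [l x] is in the
unit sphere. *)
Lemma sublevel_bounded (s : R) : exists2 M, 0 <= M &
  forall x, phi x <= s -> cube d M x.
Proof.
have [m m0 mP] := tau_le; have [c c0 cN] := is_norm_ge N_norm.
have [K K0 NK] := is_norm_le N_norm.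
pose A := powmx (s / m) E.
pose B : R := \sum_i \sum_j `|A i j|.
have B0 : 0 <= B by rewrite sumr_ge0// => ? _; rewrite sumr_ge0.
exists (K * (B * c^-1) / c).
  by rewrite divr_ge0 ?mulr_ge0 ?invr_ge0// ltW.
move=> x xs; have [->|x0] := eqVneq x 0.
  by move=> i; rewrite mxE normr0 divr_ge0 ?mulr_ge0 ?invr_ge0// ltW.
have [t0 [th [Nth xE]]] := tauP x0.
apply/cubeP; first by rewrite divr_ge0 ?mulr_ge0 ?invr_ge0// ltW.
rewrite ler_pdivlMr// mulrC (le_trans (cN _))//.
have : N x <= N (A *m th).
  rewrite {1}xE; apply: adapted_norm_mono => //.
  by rewrite ler_pdivlMr// mulrC (le_trans (mP x)).
move=> /le_trans; apply; rewrite (le_trans (NK _))// ler_wpM2l//.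
rewrite (le_trans (norm_mulmx_le _ _))// ler_wpM2l//.
by rewrite -[leRHS]mul1r ler_pdivlMr// mulrC -Nth.
Qed.

(** Scaling by [(phi y)^(- E)] reduces to the case [phi y = 1]. Such [y] range in a
bounded set away from 0, on which admissibility has a single constant. *)
Lemma admissible_increment : exists C kappa, [/\ 0 < C, 0 < kappa, kappa <= 1 &
  forall x y, phi x <= kappa * phi y ->
    `|phi (x + y) - phi y| <= C * phi y * (phi x / phi y) `^ beta].
Proof.
have [m m0 mP] := tau_le; have [M M0 MP] := sublevel_bounded 1.
(* The set [{phi = 1}] avoids a ball around 0 by continuity of [phi] at 0, and is
   bounded by [sublevel_bounded]: this gives the radii [a] and [b]. *)
have [a a0 aP] : exists2 a : R, 0 < a & forall y : 'cV[R]_d, enorm y < a -> phi y < 1.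
  have /cvgrPdist_lt/(_ 1 ltr01) := @cphi 0.
  rewrite homogeneous0 => /nbhs_ballP[a /= a0 aP]; exists a => // y ya.
  have := aP y; rewrite sub0r normrN ger0_norm//; apply.
  split => // i j; rewrite /ball/= mxE sub0r normrN ord1.
  exact: le_lt_trans (entry_le_enorm _ _) ya.
pose b := a + 1 + Num.sqrt (d%:R * M ^+ 2).
have ab : a < b by rewrite /b -addrA ltrDl ltr_wpDr ?sqrtr_ge0.
have [_ _ _ /(_ a b a0 ab)[C0 [C00 C0P]]] := phi_adm.
(* The bound by [m] ensures that [tau x <= 1] whenever [phi x <= kappa]. *)
pose kappa := Num.min 1 m.
have k0 : 0 < kappa by rewrite lt_min ltr01.
pose C := C0 * m^-1 `^ beta.
have C_gt0 : 0 < C by rewrite mulr_gt0// powR_gt0 ?invr_gt0.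
exists C, kappa; split => //; first by rewrite ge_min lexx.
have unit x y : phi y = 1 -> phi x <= kappa ->
    `|phi (x + y) - phi y| <= C * phi x `^ beta.
  move=> y1 xk.
  have tx : tau E N x <= phi x / m by rewrite ler_pdivlMr// mulrC.
  have tx0 : 0 <= tau E N x.
    have [->|/tauP[/ltW//]] := eqVneq x 0; by rewrite /tau eqxx.
  apply: (le_trans (C0P _ _ _ _)).
  - apply/andP; split; first by rewrite leNgt; apply/negP => /aP; rewrite y1 ltxx.
    have yM : cube d M y by apply: MP; rewrite y1.
    rewrite (le_trans (enorm_le M0 yM))// /b lerDr.
    by rewrite addr_ge0// ltW.
  - rewrite (le_trans tx)// ler_pdivrMr// mul1r (le_trans xk)// ge_min lexx orbT//.
  rewrite /C -mulrA ler_wpM2l ?(ltW C00)// -powRM ?invr_ge0 ?(ltW m0)//.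
  by rewrite mulrC ge0_ler_powR ?nnegrE ?divr_ge0 ?(ltW m0) ?(ltW beta_gt0).
move=> x y xy; have [y0|y0] := eqVneq y 0.
  move: xy; rewrite y0 homogeneous0 mulr0 => /(conj (phi_ge0 x))/andP/le_anti.
  move/esym/eqP; rewrite admissible_eq0 => /eqP ->.
  by rewrite addr0 homogeneous0 subrr normr0 mulr0 mul0r.
have s0 := phi_gt0 y0; set s := phi y in xy s0 *.
pose x' := powmx s^-1 E *m x; pose y' := powmx s^-1 E *m y.
have x'E : phi x' = phi x / s by rewrite homogeneousE ?invr_gt0// mulrC.
have y'E : phi y' = 1 by rewrite homogeneousE ?invr_gt0// mulVf// gt_eqF.
have -> : phi (x + y) = s * phi (x' + y').
  by rewrite -homogeneousE// -mulmxDr powmx_mulVK.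
rewrite -[X in _ - X]mulr1 -{1}y'E -mulrBr normrM gtr0_norm//.
rewrite -[leRHS]mulrA mulrCA ler_pM2l// -x'E; apply: unit => //.
by rewrite x'E ler_pdivrMr.
Qed.

(** After scaling, the larger of [phi x] and [phi y] is 1; then [x + y] ranges in a
compact set, on which [phi] is bounded. *)
Lemma admissible_quasi_triangle : exists2 K, 1 <= K &
  forall x y, phi (x + y) <= K * Num.max (phi x) (phi y).
Proof.
have [M M0 MP] := sublevel_bounded 1.
have ne : cube d (M + M) !=set0.
  by exists 0 => i; rewrite mxE normr0 addr_ge0.
have cphiM : {within cube d (M + M), continuous phi} by exact: continuous_subspaceT.
have [c _ cP] := compact_EVT_max ne (@compact_cube R d (M + M)) cphiM.
exists (1 + phi c); first by rewrite lerDl.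
move=> x y; set s := Num.max _ _.
have [sx sy] : phi x <= s /\ phi y <= s by rewrite !le_max !lexx orbT.
have [s0|s0] := ltP 0 s; last first.
  have z0 z : phi z <= s -> z = 0.
    move=> zs; apply/eqP; rewrite -admissible_eq0 eq_le phi_ge0 andbT.
    exact: le_trans s0.
  by rewrite (z0 _ sx) (z0 _ sy) addr0 homogeneous0 mulr_ge0 ?addr_ge0// le_max phi_ge0.
pose x' := powmx s^-1 E *m x; pose y' := powmx s^-1 E *m y.
have -> : phi (x + y) = s * phi (x' + y').
  by rewrite -homogeneousE// -mulmxDr powmx_mulVK.
rewrite mulrC ler_pM2r// (@le_trans _ _ (phi c)) ?lerDr//.
have hM z : phi z <= s -> cube d M (powmx s^-1 E *m z).
  move=> zs; apply: MP; rewrite homogeneousE ?invr_gt0//.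
  by rewrite mulrC ler_pdivrMr// mul1r.
apply/cP/mem_set => i; rewrite mxE (le_trans (ler_normD _ _))// lerD//.
  exact: hM.
exact: hM.
Qed.

(** With [kappa] small enough the ratio [phi (x + y) / phi y] stays within
distance 1/2 of 1, where [u^p] is Lipschitz. *)
Lemma admissible_powR_increment (p : R) : exists C kappa, [/\ 0 < C, 0 < kappa &
  forall x y, y != 0 -> phi x <= kappa * phi y ->
    `|phi (x + y) `^ p - phi y `^ p| <= C * (phi y `^ (p - beta) * phi x `^ beta)].
Proof.
have [C1 [k1 [C10 k10 k11 C1P]]] := admissible_increment.
have [C2 C20 C2P] := powR_sub1_le p.
(* The second bound makes [C1 q^beta <= 1/2] for [q = phi x / phi y <= k]. *)
pose k := Num.min k1 ((2 * C1)^-1 `^ beta^-1).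
have k0 : 0 < k by rewrite lt_min k10 powR_gt0// invr_gt0 mulr_gt0.
exists (C2 * C1), k; split => //; first by rewrite mulr_gt0.
move=> x y y0 xy; have s0 := phi_gt0 y0; set s := phi y in xy s0 *.
set q := phi x / s.
have q0 : 0 <= q by rewrite divr_ge0// ltW.
have qk : q <= k by rewrite ler_pdivrMr.
have := C1P x y; rewrite -/s -/q => /(_ _)/wrap[|C1q].
  by rewrite (le_trans xy)// ler_pM2r// ge_min lexx.
pose u := phi (x + y) / s.
have uE : phi (x + y) = s * u by rewrite mulrC divfK// gt_eqF.
have u0 : 0 <= u by rewrite divr_ge0// ltW.
have u1 : `|u - 1| <= C1 * q `^ beta.
  move: C1q; rewrite uE -[X in _ - X]mulr1 -mulrBr normrM gtr0_norm//.
  by rewrite mulrAC [C1 * _ * s]mulrC ler_pM2l.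
have Cq : C1 * q `^ beta <= 2^-1.
  have -> : 2^-1 = C1 * (2 * C1)^-1 by rewrite invfM mulrCA mulfV ?mulr1// gt_eqF.
  rewrite ler_pM2l// (@le_trans _ _ (k `^ beta))//.
    by rewrite ge0_ler_powR ?nnegrE ?(ltW k0)// ltW.
  rewrite (@le_trans _ _ (((2 * C1)^-1 `^ beta^-1) `^ beta))//.
    rewrite ge0_ler_powR ?nnegrE ?powR_ge0 ?(ltW k0) ?(ltW beta_gt0)//.
    by rewrite ge_min lexx orbT.
  by rewrite -powRrM mulVf ?gt_eqF// powRr1// invr_ge0 mulr_ge0// ltW.
have := le_trans u1 Cq; rewrite ler_norml => /andP[ua ub].
have := C2P u; rewrite (_ : _ <= u <= _); last by apply/andP; split; lra.
move=> /(_ isT) uP.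
rewrite uE powRM ?(ltW s0)// -[X in _ - X]mulr1 -mulrBr normrM.
rewrite ger0_norm ?powR_ge0//.
rewrite (@le_trans _ _ (s `^ p * (C2 * (C1 * q `^ beta))))//.
  by rewrite ler_wpM2l ?powR_ge0// (le_trans uP)// ler_wpM2l// ltW.
have -> : phi x = s * q by rewrite mulrC divfK// gt_eqF.
rewrite powRM ?(ltW s0)// (_ : s `^ p = s `^ (p - beta) * s `^ beta).
  by rewrite le_eqVlt; apply/orP; left; apply/eqP; ring.
by rewrite -powRD ?subrK//; apply/implyP => _; rewrite gt_eqF.
Qed.

End homogeneous.
End polar.

(** * Integrals of powers of a homogeneous function *)

Section homogeneous_integrals.
Context {R : realType} {d : nat}.
Notation leb := (@lebesgue_cV R d).
Variables (E : 'M[R]_d) (phi : 'cV[R]_d -> R).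
Hypothesis mphi : measurable_fun setT phi.
Hypothesis phi_ge0 : forall x, 0 <= phi x.
Hypothesis phiE : forall c x, 0 < c -> phi (powmx c E *m x) = c * phi x.
Hypothesis phi_bounded : forall s : R, exists2 M, 0 <= M &
  forall x, phi x <= s -> cube d M x.

Lemma scales_powmx c : 0 < c ->
  scales leb (fun x => powmx c E *m x) (c `^ (- \tr E)).
Proof.
move=> c0; rewrite powRN -[X in X^-1]ger0_norm ?powR_ge0// -det_powmx//.
by apply: scales_linear; rewrite det_powmx// gt_eqF// powR_gt0.
Qed.

Definition sublevel (s : R) := [set x | phi x <= s].

Lemma measurable_sublevel s : measurable (sublevel s).
Proof.
rewrite -[X in measurable X]setTI (_ : sublevel s = phi @^-1` [set y | y <= s])//.
by apply: mphi => //; rewrite -set_itvNyc.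
Qed.

Lemma sublevel_lty s : (leb (sublevel s) < +oo)%E.
Proof.
have [M M0 MP] := phi_bounded s.
apply: le_lt_trans (@lebesgue_cV_cube_lty R d M); apply: le_measure => //.
- by rewrite inE; exact: measurable_sublevel.
- by rewrite inE; exact: measurable_cube.
Qed.

Lemma integral_scaling (h : 'cV[R]_d -> R) (c : R) :
  measurable_fun setT h -> (forall x, 0 <= h x) -> 0 < c ->
  (\int[leb]_y (h (powmx c^-1 E *m y))%:E = (c `^ \tr E)%:E * \int[leb]_y (h y)%:E)%E.
Proof.
move=> mh h0 c0.
have ci0 : 0 < c^-1 by rewrite invr_gt0.
rewrite (scales_integral (scales_powmx ci0) (h := EFin \o h)).
- by rewrite -[c^-1]powR_inv1 ?ltW// -powRrM mulrN mulN1r opprK.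
- exact/measurable_EFinP.
- by move=> x; rewrite lee_fin.
Qed.

(** If [F] is dominated, at each point, by one of the rescaled copies of [h], then
its integral is at most the sum of theirs; by change of variables the [k]-th copy
has integral [c^(k (g + tr E))] times that of [h], a geometric series. *)
Lemma geometric_cover_lty (h F : 'cV[R]_d -> R) (c g : R) :
  measurable_fun setT h -> (forall x, 0 <= h x) ->
  (\int[leb]_y (h y)%:E < +oo)%E ->
  measurable_fun setT F -> (forall x, 0 <= F x) ->
  0 < c -> c `^ (g + \tr E) < 1 ->
  (forall y, F y != 0 -> exists k : nat,
     F y <= (c ^+ k) `^ g * h (powmx (c ^+ k)^-1 E *m y)) ->
  (\int[leb]_y (F y)%:E < +oo)%E.
Proof.
move=> mh h0 hoo mF F0 c0 c1 cover.
have ck0 k : 0 < c ^+ k by rewrite exprn_gt0.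
pose hk k y := (c ^+ k) `^ g * h (powmx (c ^+ k)^-1 E *m y).
have hk0 k y : 0 <= hk k y by rewrite mulr_ge0 ?powR_ge0.
have mhk k : measurable_fun setT (hk k).
  apply: measurable_funM => //; apply: measurableT_comp => //.
  exact: measurable_fun_linmap.
have mhkE k : measurable_fun setT (fun y => (hk k y)%:E) by exact/measurable_EFinP.
apply: (@le_lt_trans _ _ (\int[leb]_y (\sum_(k <oo) (hk k y)%:E)))%E.
  apply: ge0_le_integral => //.
  - by move=> x _; rewrite lee_fin.
  - exact/measurable_EFinP.
  - apply: (@ge0_emeasurable_sum _ _ _ _ (fun k y => (hk k y)%:E) xpredT) => //.
    by move=> k x _ _; rewrite lee_fin.
  - move=> y _; have [->|/cover[k Fk]] := eqVneq (F y) 0.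
      by apply: nneseries_ge0 => k *; rewrite lee_fin.
    apply: (@le_trans _ _ (\sum_(0 <= i < k.+1) (hk i y)%:E)%E).
      rewrite big_nat_recr//= (@le_trans _ _ (hk k y)%:E) ?lee_fin//.
      by apply: leeDr; apply: sume_ge0 => i _; rewrite lee_fin; exact: hk0.
    apply: (@nneseries_lim_ge R (fun i => (hk i y)%:E) xpredT 0 k.+1) => i _ _.
    by rewrite lee_fin; exact: hk0.
rewrite integral_nneseries//; last by move=> k x _; rewrite lee_fin.
have hkI k : (\int[leb]_y (hk k y)%:E =
    ((c `^ (g + \tr E)) ^+ k)%:E * \int[leb]_y (h y)%:E)%E.
  under eq_integral do rewrite EFinM.
  rewrite ge0_integralZl_EFin ?powR_ge0//.
  - rewrite integral_scaling// muleA -EFinM -powRD; last by apply/implyP => _; rewrite gt_eqF.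
    by rewrite -(powR_mulrn k (ltW c0)) powRAC (powR_mulrn k (powR_ge0 _ _)).
  - by move=> y _; rewrite lee_fin.
  - apply/measurable_EFinP/measurableT_comp => //; exact: measurable_fun_linmap.
under eq_eseriesr do rewrite hkI.
apply: nneseries_geometric_lty => //; first exact: powR_ge0.
by apply: integral_ge0 => y _; rewrite lee_fin.
Qed.

Definition phi_shell (I : set R) (g : R) (y : 'cV[R]_d) : R :=
  \1_I (phi y) * phi y `^ g.

Lemma phi_shell_ge0 I g y : 0 <= phi_shell I g y.
Proof. by rewrite mulr_ge0 ?powR_ge0// indicE. Qed.

Lemma measurable_phi_shell I g : measurable I ->
  measurable_fun setT (phi_shell I g).
Proof.
move=> mI; apply: measurable_funM.
  have mI1 : measurable_fun setT (\1_I : R -> R) by exact: measurable_indic.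
  exact: (measurableT_comp mI1 mphi).
exact: (measurableT_comp (measurable_powR g) mphi).
Qed.

Lemma phi_shell_lty (a b g : R) : 0 < a ->
  (\int[leb]_y (phi_shell `]a, b] g y)%:E < +oo)%E.
Proof.
move=> a0.
apply: (@le_lt_trans _ _ (\int[leb]_y ((a `^ g + b `^ g)%:E *
    (\1_(sublevel b) y)%:E)))%E.
  apply: ge0_le_integral => //.
  - by move=> y _; rewrite lee_fin phi_shell_ge0.
  - by apply/measurable_EFinP; apply: measurable_phi_shell.
  - apply: measurable_funeM; apply/measurable_EFinP/measurable_indic.
    exact: measurable_sublevel.
  - move=> y _; rewrite -EFinM lee_fin /phi_shell !indicE.
    case: (boolP (phi y \in _)) => [|_]; last first.
      by rewrite mul0r mulr_ge0 ?addr_ge0 ?powR_ge0.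
    rewrite inE/= in_itv/= => /andP[ay yb].
    rewrite mul1r mem_set//= mulr1; apply: powR_interval_le => //.
    by rewrite (ltW ay).
rewrite ge0_integralZl_EFin ?addr_ge0 ?powR_ge0//.
- rewrite integral_indic ?setIT//; last exact: measurable_sublevel.
  by apply: lte_mul_pinfty; rewrite ?lee_fin ?addr_ge0 ?powR_ge0//; exact: sublevel_lty.
- apply/measurable_EFinP/measurable_indic; exact: measurable_sublevel.
Qed.

Lemma phi_shellE I c g y : 0 < c -> phi_shell I g (powmx c^-1 E *m y) =
  \1_I (phi y / c) * (phi y / c) `^ g.
Proof. by move=> c0; rewrite /phi_shell phiE ?invr_gt0// mulrC [c^-1 * _]mulrC mulrC. Qed.

Lemma phi_shell_cover I c g y : 0 < c -> I (phi y / c) ->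
  phi y `^ g = c `^ g * phi_shell I g (powmx c^-1 E *m y).
Proof.
move=> c0 Iy; rewrite phi_shellE// indicE mem_set// mul1r -powRM//.
  by rewrite mulrC divfK// gt_eqF.
  exact: ltW.
by rewrite divr_ge0// ltW.
Qed.

(** The sublevel set is, up to the origin, the union of the shells
[2^(- n - 1) M < phi <= 2^(- n) M]. *)
Lemma integral_phi_near0_lty (M g : R) : 0 < g + \tr E ->
  (\int[leb]_y (phi_shell `]-oo, M] g y)%:E < +oo)%E.
Proof.
move=> g0; pose F1 := phi_shell (`]0, M] : set R) g.
have mS := measurable_sublevel M.
(* Where [phi] vanishes its power is at most 1 (it is 1 for [g = 0]): the
   indicator accounts for these points. *)
apply: (@le_lt_trans _ _ (\int[leb]_y ((F1 y)%:E + (\1_(sublevel M) y)%:E)))%E.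
  apply: ge0_le_integral => //.
  - by move=> y _; rewrite lee_fin phi_shell_ge0.
  - by apply/measurable_EFinP; apply: measurable_phi_shell.
  - apply: emeasurable_funD; apply/measurable_EFinP; last exact: measurable_indic.
    by apply: measurable_phi_shell.
  - move=> y _; rewrite -EFinD lee_fin /F1 /phi_shell !indicE.
    case: (boolP (phi y \in _)) => [|_]; last first.
      by rewrite mul0r addr_ge0// mulr_ge0 ?powR_ge0.
    rewrite inE/= in_itv/= => yM; rewrite mul1r (mem_set (yM : sublevel M y)).
    have [y0|y0] := ltP 0 (phi y).
      by rewrite mem_set ?mul1r ?lerDl//= in_itv/= y0.
    have -> : phi y = 0 by apply/eqP; rewrite eq_le y0 phi_ge0.
    rewrite -[leLHS]add0r lerD ?mulr_ge0 ?powR_ge0//.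
    by rewrite /powR eqxx; case: (g == 0).
rewrite ge0_integralD//; last first.
- exact/measurable_EFinP/measurable_indic.
- by apply/measurable_EFinP; apply: measurable_phi_shell.
- by move=> y _; rewrite lee_fin phi_shell_ge0.
rewrite lte_add_pinfty//; last first.
  by rewrite integral_indic ?setIT//; exact: sublevel_lty.
have [M0|M0] := leP M 0.
  rewrite integral0_eq// => y _; rewrite /F1 /phi_shell set_itv_ge ?indic0 ?mul0r//.
  by rewrite bnd_simp -leNgt.
have M20 : 0 < M / 2 by rewrite divr_gt0.
apply: (@geometric_cover_lty (phi_shell `]M / 2, M] g) F1 2^-1 g) => //.
- by apply: measurable_phi_shell.
- by move=> x; exact: phi_shell_ge0.
- exact: phi_shell_lty.
- by apply: measurable_phi_shell.
- by move=> x; exact: phi_shell_ge0.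
- rewrite /powR gt_eqF ?invr_gt0// expR_lt1 pmulr_rlt0// ln_lt0//.
  by rewrite invr_gt0 ltr0n invf_lt1// ltr1n.
move=> y; rewrite /F1 /phi_shell indicE; case: (boolP (phi y \in _)) => [|_]; last first.
  by rewrite mul0r eqxx.
rewrite inE/= in_itv/= mul1r => /andP[y0 yM] _.
have [n nP] := dyadic_down y0 yM.
exists n; rewrite -phi_shell_cover ?exprn_gt0//= in_itv/=.
by rewrite exprVn invrK.
Qed.

(** As in [integral_phi_near0_lty], with the shells [2^n M < phi <= 2^(n + 1) M]. *)
Lemma integral_phi_far_lty (M g : R) : 0 < M -> g + \tr E < 0 ->
  (\int[leb]_y (phi_shell `]M, +oo[ g y)%:E < +oo)%E.
Proof.
move=> M0 g0.
apply: (@geometric_cover_lty (phi_shell `]M, M * 2] g) _ 2 g) => //.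
- by apply: measurable_phi_shell.
- by move=> x; exact: phi_shell_ge0.
- exact: phi_shell_lty.
- by apply: measurable_phi_shell.
- by move=> x; exact: phi_shell_ge0.
- by rewrite /powR gt_eqF// expR_lt1 nmulr_rlt0// ln_gt0// ltr1n.
move=> y; rewrite /phi_shell indicE; case: (boolP (phi y \in _)) => [|_]; last first.
  by rewrite mul0r eqxx.
rewrite inE/= in_itv/= andbT mul1r => yM _.
have [n nP] := dyadic_up M0 yM.
exists n; rewrite -phi_shell_cover ?exprn_gt0//= in_itv/=.
by rewrite -exprVn.
Qed.

End homogeneous_integrals.

(** * The moving-average kernel *)

Section kernel.
Context {R : realType} {d : nat}.
Notation leb := (@lebesgue_cV R d).
Variables (E : 'M[R]_d) (N : 'cV[R]_d -> R) (beta : R) (phi : 'cV[R]_d -> R).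
Hypothesis d_gt0 : (0 < d)%N.
Hypothesis hN : adapted_norm E N.
Hypothesis beta_gt0 : 0 < beta.
Hypothesis phi_hom : homogeneous_fun E phi.
Hypothesis phi_adm : admissible_fun beta E N phi.
Variables (alpha H : R).
Hypothesis alpha_gt0 : 0 < alpha.
Hypothesis H_gt0 : 0 < H.
Hypothesis H_lt_beta : H < beta.

Let p := H - \tr E / alpha.

Let phi_ge0 x : 0 <= phi x. Proof. by have [] := phi_adm. Qed.

Let phiE c x : 0 < c -> phi (powmx c E *m x) = c * phi x.
Proof. exact: (homogeneousE d_gt0 hN phi_hom phi_adm). Qed.

Let phi_eq0 x : (phi x == 0) = (x == 0).
Proof. exact: (admissible_eq0 d_gt0 hN phi_hom phi_adm). Qed.

Let phi_bounded s : exists2 M, 0 <= M & forall x, phi x <= s -> cube d M x.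
Proof. exact: (sublevel_bounded d_gt0 hN phi_hom phi_adm). Qed.

Let mphi : measurable_fun setT phi.
Proof. by apply: continuous_measurable_cV; have [] := phi_adm. Qed.

(** The integrand to which [z = x0 - y] brings the distance between the kernels at
[x0] and at [x0 + x]. *)
Definition increment_powR x z : R := `|phi (x + z) `^ p - phi z `^ p| `^ alpha.

Lemma increment_powR_ge0 x z : 0 <= increment_powR x z.
Proof. exact: powR_ge0. Qed.

Lemma measurable_increment_powR x : measurable_fun setT (increment_powR x).
Proof.
apply: (measurableT_comp (measurable_powR alpha)).
apply: (measurableT_comp (@normr_measurable R setT)).
apply: measurable_funB.
  apply: (measurableT_comp (measurable_powR p)).
  apply: measurableT_comp => //; apply: measurable_fun_addcV => //.
by apply: (measurableT_comp (measurable_powR p)).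
Qed.

Let palpha : p * alpha + \tr E = H * alpha.
Proof. by rewrite /p; field; rewrite gt_eqF. Qed.

(** Where [phi z] is large the increment is controlled by
[admissible_powR_increment]; elsewhere its two terms are integrated separately,
the first after the translation by [x]. *)
Lemma integral_increment_unit : exists2 C : R, 0 <= C & forall x, phi x = 1 ->
  (\int[leb]_z (increment_powR x z)%:E <= C%:E)%E.
Proof.
have [C [kappa [C0 k0 CP]]] := admissible_powR_increment d_gt0 hN beta_gt0 phi_hom phi_adm p.
have [K K1 KP] := admissible_quasi_triangle d_gt0 hN phi_hom phi_adm.
(* For [phi x = 1], [phi z > M] is the condition under which increments are
   controlled, and [phi z <= M] implies [phi (x + z) <= M']. *)
pose M := kappa^-1; have M0 : 0 < M by rewrite invr_gt0.
pose M' := K * Num.max 1 M.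
pose g1 := p * alpha; pose g2 := (p - beta) * alpha.
pose F1 := phi_shell phi `]M, +oo[ g2.
pose F2 := phi_shell phi `]-oo, M] g1.
pose F3 := phi_shell phi `]-oo, M'] g1.
have F1oo : (\int[leb]_z (F1 z)%:E < +oo)%E.
  apply: (integral_phi_far_lty mphi phi_ge0 phiE phi_bounded) => //.
  rewrite /g2 mulrBl addrAC palpha -mulrBl pmulr_llt0// subr_lt0//.
have g10 : 0 < g1 + \tr E by rewrite palpha mulr_gt0.
have F2oo : (\int[leb]_z (F2 z)%:E < +oo)%E.
  exact: (integral_phi_near0_lty mphi phi_ge0 phiE phi_bounded).
have F3oo : (\int[leb]_z (F3 z)%:E < +oo)%E.
  exact: (integral_phi_near0_lty mphi phi_ge0 phiE phi_bounded).
have Fge0 I g z : 0 <= phi_shell phi I g z by exact: phi_shell_ge0.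
have mF I g : measurable I -> measurable_fun setT (phi_shell phi I g).
  by move=> mI; apply: measurable_phi_shell.
have I0 I g : (0 <= \int[leb]_z (phi_shell phi I g z)%:E)%E.
  by apply: integral_ge0 => z _; rewrite lee_fin.
pose B := fun z x : 'cV[R]_d => C `^ alpha * F1 z + (F2 z + F3 (z + x)).
have fin I g : (\int[leb]_z (phi_shell phi I g z)%:E < +oo)%E ->
    exists2 i : R, 0 <= i & (\int[leb]_z (phi_shell phi I g z)%:E)%E = i%:E.
  move=> foo; exists (fine (\int[leb]_z (phi_shell phi I g z)%:E)).
    exact/fine_ge0/I0.
  by rewrite fineK// ge0_fin_numE.
have [i1 i1_ge0 I1] := fin _ _ F1oo.
have [i2 i2_ge0 I2] := fin _ _ F2oo.
have [i3 i3_ge0 I3] := fin _ _ F3oo.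
exists (C `^ alpha * i1 + (i2 + i3)).
  by rewrite addr_ge0 ?addr_ge0 ?mulr_ge0 ?powR_ge0.
move=> x x1.
have mF3 : measurable_fun setT (fun z : 'cV[R]_d => F3 (z + x)).
  apply: measurableT_comp; first exact: mF.
  by apply: measurable_fun_addcV.
apply: (@le_trans _ _ (\int[leb]_z (B z x)%:E)%E).
  apply: ge0_le_integral => //.
  - by move=> z _; rewrite lee_fin increment_powR_ge0.
  - apply/measurable_EFinP. exact: measurable_increment_powR.
  - apply/measurable_EFinP/measurable_funD.
      by apply: measurable_funM => //; exact: mF.
    by apply: measurable_funD => //; exact: mF.
  move=> z _; rewrite lee_fin /increment_powR /B.
  have [zM|zM] := ltP M (phi z).
    have z0 : z != 0 by rewrite -phi_eq0 gt_eqF// (lt_trans _ zM).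
    rewrite ler_wpDr ?addr_ge0 ?Fge0//.
    rewrite /F1 /phi_shell indicE mem_set/=; last by rewrite in_itv/= zM.
    rewrite mul1r /g2 [X in _ <= _ * X]powRrM -powRM ?powR_ge0 ?(ltW C0)//.
    rewrite ge0_ler_powR ?nnegrE ?(ltW alpha_gt0) ?mulr_ge0 ?powR_ge0 ?(ltW C0)//.
    have := CP x z z0; rewrite x1 powR1 mulr1; apply.
    by rewrite mulrC -ler_pdivrMr// mul1r ltW.
  rewrite ler_wpDl ?mulr_ge0 ?powR_ge0 ?Fge0//.
  rewrite /F2 /F3 /phi_shell !indicE mem_set/=; last by rewrite in_itv/=.
  rewrite mem_set/=; last first.
    rewrite in_itv/= addrC (le_trans (KP _ _))// x1 /M' ler_wpM2l//.
      exact: le_trans K1.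
    by rewrite ge_max !le_max lexx zM orbT.
  rewrite !mul1r /g1 !powRrM [leRHS]addrC [z + x]addrC.
  exact: (powR_dist_le (powR_ge0 _ _) (powR_ge0 _ _) (ltW alpha_gt0)).
rewrite /B; under eq_integral do rewrite EFinD EFinM EFinD.
rewrite ge0_integralD//; last first.
- apply/measurable_EFinP; apply: measurable_funD => //; exact: mF.
- by move=> z _; rewrite -EFinD lee_fin addr_ge0 ?Fge0.
- by apply: measurable_funeM; apply/measurable_EFinP; exact: mF.
- by move=> z _; rewrite -EFinM lee_fin mulr_ge0 ?powR_ge0 ?Fge0.
rewrite ge0_integralD//; last first.
- exact/measurable_EFinP.
- by move=> z _; rewrite lee_fin Fge0.
- by apply/measurable_EFinP; exact: mF.
- by move=> z _; rewrite lee_fin Fge0.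
rewrite ge0_integralZl_EFin ?powR_ge0//; last first.
- by apply/measurable_EFinP; exact: mF.
- by move=> z _; rewrite lee_fin Fge0.
rewrite (scales_integral (scales_translation x) (h := EFin \o F3)); last first.
- by move=> z; rewrite lee_fin Fge0.
- by apply/measurable_EFinP; exact: mF.
by rewrite mul1e /comp I1 I2 I3; exact: lexx.
Qed.

(** Scaling by [(phi x)^(- E)] reduces to [phi x = 1]; the exponents combine to
[p alpha + tr E = H alpha]. *)
Lemma integral_increment_le : exists2 C : R, 0 <= C & forall x,
  (\int[leb]_z (increment_powR x z)%:E <= (C * phi x `^ (H * alpha))%:E)%E.
Proof.
have [C C0 CP] := integral_increment_unit; exists C => // x.
have [->|x0] := eqVneq x 0.
  rewrite integral0_eq ?lee_fin ?mulr_ge0 ?powR_ge0// => z _.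
  by rewrite /increment_powR add0r subrr normr0 powR0// gt_eqF.
have s0 : 0 < phi x by rewrite lt_neqAle eq_sym phi_eq0 x0 phi_ge0.
set s := phi x in s0 *.
pose x1 := powmx s^-1 E *m x.
have x11 : phi x1 = 1 by rewrite phiE ?invr_gt0// mulVf// gt_eqF.
have incE z : increment_powR x z = s `^ (p * alpha) * increment_powR x1 (powmx s^-1 E *m z).
  rewrite /increment_powR -mulmxDr !phiE ?invr_gt0//.
  rewrite !powRM ?invr_ge0 ?(ltW s0)// -mulrBr normrM [ `|s^-1 `^ p|]ger0_norm ?powR_ge0//.
  rewrite powRM ?powR_ge0// mulrA -powRrM -powRM ?invr_ge0 ?(ltW s0)//.
  by rewrite mulfV ?gt_eqF// powR1 mul1r.
under eq_integral do rewrite incE EFinM.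
rewrite ge0_integralZl_EFin ?powR_ge0//; last first.
- apply/measurable_EFinP/measurableT_comp; first exact: measurable_increment_powR.
  exact: measurable_fun_linmap.
- by move=> z _; rewrite lee_fin increment_powR_ge0.
rewrite integral_scaling//; last first.
- exact: increment_powR_ge0.
- exact: measurable_increment_powR.
rewrite muleA -EFinM -powRD ?palpha; last by apply/implyP => _; rewrite gt_eqF.
by rewrite [C * _]mulrC EFinM lee_pmul2l ?lte_fin ?powR_gt0// CP.
Qed.

Lemma measurable_ma_kernel x : measurable_fun setT (ma_kernel E phi alpha H x).
Proof.
have mN : measurable_fun setT (-%R : 'cV[R]_d -> 'cV[R]_d) by have [] := @scales_opp R d.
apply: measurable_funB; apply: (measurableT_comp (measurable_powR _)).
  apply: measurableT_comp => //; apply: measurable_fun_addcV => //.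
exact: measurableT_comp.
Qed.

Lemma ma_kernel_dist : exists2 C : R, 0 <= C & forall x x0,
  (\int[leb]_y (`|ma_kernel E phi alpha H x y - ma_kernel E phi alpha H x0 y| `^ alpha)%:E
    <= (C * phi (x - x0) `^ (H * alpha))%:E)%E.
Proof.
have [C C0 CP] := integral_increment_le; exists C => // x x0.
have sc : scales leb (fun y => - y + x0) 1.
  rewrite -[X in scales _ _ X](mulr1 1).
  exact: (scales_comp (@scales_opp R d) (scales_translation x0)).
apply: le_trans (CP (x - x0)); rewrite -[leRHS]mul1e.
have <- := scales_integral sc (h := EFin \o increment_powR (x - x0)).
- rewrite le_eqVlt; apply/orP; left; apply/eqP/eq_integral => y _ /=.
  rewrite /increment_powR /ma_kernel.
  have -> : x - x0 + (- y + x0) = x - y by rewrite (addrC (- y)) addrA subrK.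
  by rewrite (addrC (- y)) opprB addrA subrK.
- by apply/measurable_EFinP; exact: measurable_increment_powR.
- by move=> z; rewrite lee_fin increment_powR_ge0.
Qed.

(** The kernel vanishes identically at [x0 = 0], so that its integrability is the
case [x0 = 0] of [ma_kernel_dist]. *)
Lemma ma_kernel_Lalpha x : Lalpha alpha (ma_kernel E phi alpha H x).
Proof.
split; first exact: measurable_ma_kernel.
have [C C0 CP] := ma_kernel_dist.
apply: le_lt_trans (le_trans _ (CP x 0)) (ltry _).
rewrite le_eqVlt; apply/orP; left; apply/eqP/eq_integral => y _ /=.
by rewrite {3}/ma_kernel sub0r subrr subr0.
Qed.

End kernel.

(** * Sums of independent stable variables *)

Section independence.
Context {R : realType}.

(** Measurable rectangles form a pi-system that generates the product
sigma-algebra. *)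
Lemma measure_rectangle_unique d1 d2 (T1 : measurableType d1)
    (T2 : measurableType d2) (m1 m2 : {measure set (T1 * T2) -> \bar R}) :
  (m1 setT < +oo)%E ->
  (forall A B, measurable A -> measurable B -> m1 (A `*` B) = m2 (A `*` B)) ->
  forall X, measurable X -> m1 X = m2 X.
Proof.
move=> m1oo m12.
pose C : set (set (T1 * T2)) :=
  [set C | exists A, measurable A /\ exists B, measurable B /\ C = A `*` B].
have CI : setI_closed C.
  move=> /= _ _ [X1 [mX1 [X2 [mX2 ->]]]] [Y1 [mY1 [Y2 [mY2 ->]]]].
  rewrite -setXI; exists (X1 `&` Y1); split; first exact: measurableI.
  by exists (X2 `&` Y2); split => //; exact: measurableI.
move=> X mX; apply: (measure_unique C (fun=> setT)) => //.
- rewrite measurable_prod_measurableType //; congr (<<s _ >>).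
  rewrite predeqE; split => [[A mA [B mB <-]]|[A [mA [B [mB ->]]]]].
    by exists A; split => //; exists B.
  by exists A => //; exists B.
- by move=> n; exists setT; split => //; exists setT; split => //; rewrite setXTT.
- by rewrite bigcup_const//; exists 0%N.
- by move=> _ [A [mA [B [mB ->]]]]; exact: m12.
Qed.

Context {dO : measure_display} {Omega : measurableType dO}.
Variable P : probability Omega R.

(** The event [D] stands for the conditions on all remaining variables; carrying
it along lets independence be propagated from one partial sum to the next. *)
Definition indep_pair (U V : Omega -> R) (D : set Omega) := forall A C : set R,
  measurable A -> measurable C ->
  P (U @^-1` A `&` V @^-1` C `&` D) = (P (U @^-1` A) * P (V @^-1` C) * P D)%E.

Lemma indep_pair_joint (U V : Omega -> R) (D : set Omega) (M : set (R * R)) :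
  measurable_fun setT U -> measurable_fun setT V -> measurable D ->
  indep_pair U V setT -> indep_pair U V D -> measurable M ->
  P ((fun w => (U w, V w)) @^-1` M `&` D) =
  (P ((fun w => (U w, V w)) @^-1` M) * P D)%E.
Proof.
move=> mU mV mD UV UVD mM; pose W w := (U w, V w).
have mW : measurable_fun setT W by exact: measurable_fun_pair.
have PD0 : 0 <= fine (P D) by exact: fine_ge0.
pose n1 : {measure set (R * R) -> \bar R} :=
  measure_function_pushforward__canonical__measure_function_Measure
    (mrestr P mD) mW.
pose n2 : {measure set (R * R) -> \bar R} := mscale (NngNum PD0)
  (measure_function_pushforward__canonical__measure_function_Measure P mW).
have PDE : (fine (P D))%:E = P D by rewrite fineK// fin_num_measure.
transitivity (n1 M); first by [].
rewrite muleC -PDE; transitivity (n2 M); last by [].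
apply: (measure_rectangle_unique _ _ mM).
  rewrite /n1/= /pushforward/= /mrestr preimage_setT setTI.
  by rewrite (le_lt_trans (probability_le1 P mD))// ltry.
move=> A C mA mC; rewrite /n1 /n2/= /mscale/= /pushforward/= /mrestr PDE.
have -> : W @^-1` (A `*` C) = U @^-1` A `&` V @^-1` C by [].
rewrite UVD//; have := UV A C mA mC; rewrite setIT probability_setT mule1 => ->.
by rewrite muleC.
Qed.

Lemma indep_pair_sum (U V : Omega -> R) (D : set Omega) (a : R) A :
  measurable_fun setT U -> measurable_fun setT V -> measurable D ->
  indep_pair U V setT -> indep_pair U V D -> measurable A ->
  P ((fun w => U w + a * V w)%R @^-1` A `&` D) =
  (P ((fun w => U w + a * V w)%R @^-1` A) * P D)%E.
Proof.
move=> mU mV mD UV UVD mA.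
apply: (indep_pair_joint (M := (fun p : R * R => p.1 + a * p.2) @^-1` A)) => //.
rewrite -[X in measurable X]setTI.
have mg : measurable_fun setT (fun p : R * R => p.1 + a * p.2).
  apply: measurable_funD; first exact: measurable_fst.
  by apply: measurable_funM => //; exact: measurable_snd.
exact: mg.
Qed.

Lemma bounded_integrable d (T : measurableType d) (Q : probability T R)
  (f : T -> R) : measurable_fun setT f -> (forall x, `|f x| <= 1) ->
  Q.-integrable setT (EFin \o f).
Proof.
move=> mf f1; apply: measurable_bounded_integrable => //.
  by rewrite -ge0_fin_numE// fin_num_measure.
exists 1; split; first exact: num_real.
by move=> r r1 x _; rewrite /= (le_trans (f1 x))// ltW.
Qed.

(** The joint law of independent variables is the product of their laws, so this
is Fubini's theorem. *)
Lemma integral_indep_mul (U V : Omega -> R) (f g : R -> R) :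
  measurable_fun setT U -> measurable_fun setT V -> indep_pair U V setT ->
  measurable_fun setT f -> measurable_fun setT g ->
  (forall x, `|f x| <= 1) -> (forall x, `|g x| <= 1) ->
  (\int[P]_w (f (U w) * g (V w))%:E =
   \int[P]_w (f (U w))%:E * \int[P]_w (g (V w))%:E)%E.
Proof.
move=> mU mV UV mf mg f1 g1.
pose U' : {mfun Omega >-> R} :=
  HB.pack U (@isMeasurableFun.Build _ _ Omega R U mU).
pose V' : {mfun Omega >-> R} :=
  HB.pack V (@isMeasurableFun.Build _ _ Omega R V mV).
pose W w := (U w, V w).
have mW : measurable_fun setT W by exact: measurable_fun_pair.
pose J : {measure set (R * R) -> \bar R} :=
  measure_function_pushforward__canonical__measure_function_Measure P mW.
pose m1 := distribution P U'; pose m2 := distribution P V'.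
have JE X : measurable X -> (m1 \x m2)%E X = J X.
  apply: product_measure_unique => A B mA mB.
  by have := UV A B mA mB; rewrite setIT probability_setT mule1 => <-.
pose h (p : R * R) := f p.1 * g p.2.
have mh : measurable_fun setT h.
  apply: measurable_funM.
    exact: (measurableT_comp mf (@measurable_fst _ _ _ _)).
  exact: (measurableT_comp mg (@measurable_snd _ _ _ _)).
have h1 p : `|h p| <= 1.
  by rewrite normrM -[1]mulr1 ler_pM.
transitivity (\int[m1 \x m2]_z (h z)%:E)%E.
  transitivity (\int[J]_z (h z)%:E)%E.
    rewrite integral_pushforward//.
      exact/measurable_EFinP.
    apply: (@bounded_integrable _ _ _ (h \o W)) => [|w]; last exact: h1.
    exact: (measurableT_comp mh mW).
  by apply: eq_measure_integral => X mX _; rewrite -JE.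
rewrite -integral12_prod_meas1; last first.
  by apply: bounded_integrable.
rewrite /fubini_F/h/=.
have intf : P.-integrable setT (EFin \o (f \o U)).
  apply: bounded_integrable => [|w]; last exact: f1.
  exact: (measurableT_comp mf mU).
have intg : P.-integrable setT (EFin \o (g \o V)).
  apply: bounded_integrable => [|w]; last exact: g1.
  exact: (measurableT_comp mg mV).
have Eg : (\int[P]_w (g (V w))%:E = \int[m2]_y (g y)%:E)%E.
  by rewrite integral_pushforward//; exact/measurable_EFinP.
have Ef : (\int[P]_w (f (U w))%:E = \int[m1]_y (f y)%:E)%E.
  by rewrite integral_pushforward//; exact/measurable_EFinP.
rewrite Eg Ef.
have intg2 : m2.-integrable setT (EFin \o g) by exact: bounded_integrable.
have intf2 : m1.-integrable setT (EFin \o f) by exact: bounded_integrable.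
under eq_integral => x _.
  under eq_integral do rewrite EFinM.
  rewrite integralZl//; over.
have gfin : (\int[m2]_y (g y)%:E)%E \is a fin_num by exact: integrable_fin_num.
rewrite -(fineK gfin) integralZr//.
Qed.

(** [SaS_law] for a plain function, as applied to sums and differences. *)
Definition SaS_char (alpha s : R) (Y : Omega -> R) := forall t : R,
  (\int[P]_w (cos (t * Y w))%:E = (expR (- (`|t| `^ alpha * s)))%:E)%E /\
  (\int[P]_w (sin (t * Y w))%:E = 0)%E.

Let cos1 x : `|cos x| <= 1 :> R.
Proof. exact: cos_max. Qed.

Let sin1 x : `|sin x| <= 1 :> R.
Proof. exact: sin_max. Qed.

Let mcos (t : R) : measurable_fun setT (fun x : R => cos (t * x)).
Proof.
apply: (@measurableT_comp _ _ _ _ _ _ (@cos R)) => //.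
by apply: continuous_measurable_fun; exact: continuous_cos.
Qed.

Let msin (t : R) : measurable_fun setT (fun x : R => sin (t * x)).
Proof.
apply: (@measurableT_comp _ _ _ _ _ _ (@sin R)) => //.
by apply: continuous_measurable_fun; exact: continuous_sin.
Qed.

(** The addition formulas of [cos] and [sin] and independence; every product
with a sine has mean 0, because the laws are symmetric. *)
Lemma SaS_char_indep_sum (U V : Omega -> R) alpha s1 s2 a :
  measurable_fun setT U -> measurable_fun setT V -> indep_pair U V setT ->
  SaS_char alpha s1 U -> SaS_char alpha s2 V ->
  SaS_char alpha (s1 + `|a| `^ alpha * s2) (fun w => U w + a * V w).
Proof.
move=> mU mV UV cU cV t.
have [cUt sUt] := cU t; have [cVt sVt] := cV (t * a).
have intM (f g : R -> R) : measurable_fun setT f -> measurable_fun setT g ->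
    (forall x, `|f x| <= 1) -> (forall x, `|g x| <= 1) ->
    P.-integrable setT (fun w => (f (U w) * g (V w))%:E).
  move=> mf mg f1 g1; apply: (@bounded_integrable _ _ _ (fun w => f (U w) * g (V w))).
    by apply: measurable_funM; [exact: (measurableT_comp mf)|exact: (measurableT_comp mg)].
  by move=> w; rewrite normrM -[1]mulr1 ler_pM.
split.
  transitivity (\int[P]_w ((cos (t * U w) * cos (t * a * V w))%:E -
      (sin (t * U w) * sin (t * a * V w))%:E))%E.
    by apply: eq_integral => w _; rewrite -EFinB mulrDr mulrA cosD.
  rewrite integralB//.
  - rewrite (integral_indep_mul mU mV UV (mcos t) (mcos (t * a)))//.
    rewrite (integral_indep_mul mU mV UV (msin t) (msin (t * a)))//.
    rewrite cUt cVt sUt sVt mule0 sube0 -EFinM -expRD -opprD.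
    by rewrite normrM powRM// mulrDr mulrA.
  - by apply: (intM _ _ (mcos t) (mcos (t * a))).
  - by apply: (intM _ _ (msin t) (msin (t * a))).
transitivity (\int[P]_w ((sin (t * U w) * cos (t * a * V w))%:E +
    (cos (t * U w) * sin (t * a * V w))%:E))%E.
  by apply: eq_integral => w _; rewrite -EFinD mulrDr mulrA sinD.
rewrite integralD//.
- rewrite (integral_indep_mul mU mV UV (msin t) (mcos (t * a)))//.
  rewrite (integral_indep_mul mU mV UV (mcos t) (msin (t * a)))//.
  by rewrite sUt sVt mul0e mule0 adde0.
- by apply: (intM _ _ (msin t) (mcos (t * a))).
- by apply: (intM _ _ (mcos t) (msin (t * a))).
Qed.

(** Induction on the number of summed variables. The hypothesis is strengthened:
the partial sum is independent of every event on the variables not yet summed,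
which makes the next variable independent of it. *)
Lemma SaS_char_sum n (X : 'I_n -> {RV P >-> R}) (a s : 'I_n -> R) alpha :
  mutually_independent X -> (forall i, SaS_char alpha (s i) (X i)) ->
  SaS_char alpha (\sum_i `|a i| `^ alpha * s i) (fun w => \sum_i a i * X i w).
Proof.
move=> indX cX.
pose S k w := \sum_(i < n | (i < k)%N) a i * X i w.
pose cyl (B : 'I_n -> set R) := \bigcap_(i in setT) (X i @^-1` B i).
have mcyl B : (forall i, measurable (B i)) -> measurable (cyl B).
  move=> mB; apply: fin_bigcap_measurable; first exact: finite_finset.
  by move=> i _; rewrite -[X in measurable X]setTI; exact: measurable_funP.
have mS k : measurable_fun setT (S k).
  rewrite (_ : S k = (fun w => \sum_(i < n) (if (i < k)%N then a i * X i w else 0))).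
    by apply: measurable_sum => i; case: (i < k)%N => //; exact: measurable_funM.
  by apply/funext => w; rewrite /S big_mkcond.
suff main k : (k <= n)%N ->
    (forall A B, measurable A -> (forall i, measurable (B i)) ->
      (forall i : 'I_n, (i < k)%N -> B i = setT) ->
      (P (S k @^-1` A `&` cyl B) = P (S k @^-1` A) * P (cyl B))%E) /\
    SaS_char alpha (\sum_(i < n | (i < k)%N) `|a i| `^ alpha * s i) (S k).
  have [_ ] := main n (leqnn n).
  rewrite (eq_bigl xpredT) => [|i]; last by rewrite ltn_ord.
  congr SaS_char; apply/funext => w; apply: eq_bigl => i; exact: ltn_ord.
elim: k => [_|k IH kn].
  have S0 : S 0%N = cst 0 by apply/funext => w; rewrite /S big_pred0.
  split.
    move=> A B mA mB _; rewrite S0 preimage_cst; case: ifPn => _.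
      by rewrite setTI probability_setT mul1e.
    by rewrite set0I measure0 mul0e.
  move=> t; rewrite big_pred0//; split.
    transitivity (\int[P]_w (cst 1%E w))%E.
      by apply: eq_integral => w _; rewrite S0 /= mulr0 cos0.
    rewrite integral_cst// mul1e mulr0 oppr0 expR0.
    exact: (@probability_setT _ _ _ P).
  by rewrite integral0_eq// => w _; rewrite S0 /= mulr0 sin0.
have [indS cS] := IH (ltnW kn).
pose i0 := Ordinal kn.
have SE : S k.+1 = (fun w => S k w + a i0 * X i0 w).
  apply/funext => w; rewrite /S (bigD1 i0)/= ?ltnS// addrC; congr (_ + _).
  by apply: eq_bigl => i; rewrite ltnS ltn_neqAle andbC.
have mX i : measurable_fun setT (X i) by exact: measurable_funP.
have indD (B : 'I_n -> set R) : (forall i, measurable (B i)) ->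
    (forall i : 'I_n, (i < k.+1)%N -> B i = setT) ->
    indep_pair (S k) (X i0) (cyl B).
  move=> mB BT A C mA mC.
  pose B' i := if i == i0 then C else B i.
  have mB' i : measurable (B' i) by rewrite /B'; case: ifP.
  have -> : S k @^-1` A `&` X i0 @^-1` C `&` cyl B = S k @^-1` A `&` cyl B'.
    rewrite -setIA; congr (_ `&` _); apply/seteqP; split => w /=.
      by move=> [Cw Bw] i _; rewrite /B' /=; case: eqP => [->//|_]; exact: Bw.
    move=> B'w; split; first by have := B'w i0 Logic.I; rewrite /B' eqxx.
    move=> i _ /=; have := B'w i Logic.I; rewrite /B'; case: eqP => // -> _.
    by rewrite BT/=.
  rewrite indS//; last first.
    move=> i ik; rewrite /B' ifF; first by apply: BT; rewrite ltnS ltnW.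
    by apply/negbTE/eqP => ii0; rewrite ii0 ltnn in ik.
  rewrite /cyl !indX// (bigD1 i0)//= [in RHS](bigD1 i0)//=.
  rewrite {1}/B' eqxx BT//= preimage_setT probability_setT mul1e -muleA.
  congr (_ * (_ * _))%E; apply: eq_bigr => i /negbTE ii0.
  by rewrite /B' ii0.
have cylT : cyl (fun=> setT) = setT by apply/seteqP; split.
have indT : indep_pair (S k) (X i0) setT.
  by rewrite -cylT; apply: indD.
split.
  move=> A B mA mB BT; rewrite SE; apply: indep_pair_sum => //; first exact: mcyl.
  exact: indD.
rewrite SE (bigD1 i0)/= ?ltnS// addrC.
rewrite (eq_bigl (fun i : 'I_n => (i < k)%N)); last first.
  by move=> i; rewrite ltnS ltn_neqAle andbC.
exact: SaS_char_indep_sum.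
Qed.

End independence.

(** * A tail bound for stable variables *)

Section weak_markov.
Context {R : realType} {dO : measure_display} {Omega : measurableType dO}.
Variable P : probability Omega R.

Lemma measurable_exceed (V : Omega -> R) e : measurable_fun setT V ->
  measurable [set w | e <= `|V w|].
Proof.
move=> mV; rewrite (_ : [set w | _] = (fun w => `|V w|) @^-1` `[e, +oo[); last first.
  by apply/seteqP; split => w /=; rewrite in_itv/= andbT.
rewrite -[X in measurable X]setTI.
by apply: (measurableT_comp (@normr_measurable R setT) mV) => //; exact: measurable_itv.
Qed.

(** The sum of the geometric series over dyadic shells in [SaS_char_markov]. *)
Definition markov_const (alpha : R) : R := ((1 - cos 1) * (1 - 2^-1 `^ alpha))^-1.

Lemma cos1_lt1 : cos 1 < 1 :> R.
Proof.
have pi2 := @pi_ge2 R.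
rewrite -[ltRHS]cos0 ltr_cos ?in_itv/= ?lexx ?ler01/=//; lra.
Qed.

Lemma cos_le_cos1 (u : R) : 1 <= `|u| <= 2 -> cos u <= cos 1.
Proof.
have pi2 := @pi_ge2 R.
move=> /andP[u1 u2]; have -> : cos u = cos `|u|.
  have [u0|u0] := leP 0 u; first by rewrite ger0_norm.
  by rewrite ltr0_norm// cosN.
rewrite leNgt ltr_cos ?in_itv/= -?leNgt//; apply/andP; split; lra.
Qed.

Lemma markov_const_gt0 alpha : 0 < alpha -> 0 < markov_const alpha.
Proof.
by move=> a0; rewrite invr_gt0 mulr_gt0// subr_gt0 ?cos1_lt1 ?powR_inv2_lt1.
Qed.

(** Stable variables may have infinite moments, so the Chebyshev argument is
applied to the bounded variable [1 - cos (Y / r)]. It is at least [1 - cos 1] on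
the shell, and its mean is [1 - exp (- s / r^alpha) <= s / r^alpha]. *)
Lemma SaS_char_shell (Y : Omega -> R) (alpha s r : R) :
  measurable_fun setT Y -> 0 <= s -> SaS_char P alpha s Y -> 0 < r ->
  (P [set w | (r <= `|Y w| <= 2 * r)%R] <=
     ((1 - cos 1)^-1 * (r^-1 `^ alpha * s))%:E)%E.
Proof.
move=> mY s0 cY r0.
have c1 : 0 < 1 - cos 1 :> R by rewrite subr_gt0 cos1_lt1.
set A := [set w | _].
have mA : measurable A.
  rewrite (_ : A = (fun w => `|Y w|) @^-1` `[r, 2 * r]); last first.
    by apply/seteqP; split => w /=; rewrite in_itv.
  rewrite -[X in measurable X]setTI.
  by apply: (measurableT_comp (@normr_measurable R setT) mY) => //; exact: measurable_itv.
have mc : measurable_fun setT (fun w => cos (r^-1 * Y w)).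
  apply: (@measurableT_comp _ _ _ _ _ _ (@cos R)).
    by apply: continuous_measurable_fun; exact: continuous_cos.
  exact: measurable_funM.
have E1 : (\int[P]_w (1 - cos (r^-1 * Y w))%:E =
    (1 - expR (- (r^-1 `^ alpha * s)))%:E)%E.
  under eq_integral do rewrite EFinB.
  rewrite integralB//.
  - have [-> _] := cY r^-1; rewrite integral_cst// mul1e.
    rewrite gtr0_norm ?invr_gt0// [RHS]EFinB; congr (_ - _)%E.
    exact: (@probability_setT _ _ _ P).
  - by apply: (@bounded_integrable _ _ _ _ (cst 1)) => // w; rewrite normr1.
  - by apply: bounded_integrable => // w; exact: cos_max.
have E2 : ((1 - cos 1)%:E * P A <= \int[P]_w (1 - cos (r^-1 * Y w))%:E)%E.
  rewrite -[A]setIT -integral_indic// -ge0_integralZl_EFin ?(ltW c1)//; last first.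
    by apply/measurable_EFinP/measurable_indic.
  apply: ge0_le_integral => //.
  - by apply: measurable_funeM; apply/measurable_EFinP/measurable_indic.
  - by apply/measurable_EFinP; apply: measurable_funB.
  - move=> w _; rewrite -EFinM lee_fin indicE.
    case: (boolP (w \in A)) => [/set_mem|_]; last first.
      by rewrite mulr0 subr_ge0 cos_le1.
    rewrite /A/= mulr1 => /andP[wr w2].
    rewrite lerB// cos_le_cos1// normrM gtr0_norm ?invr_gt0// mulrC.
    by rewrite ler_pdivlMr// ler_pdivrMr// mul1r wr.
by rewrite EFinM lee_pdivlMl// (le_trans E2)// E1 lee_fin lerBlDr -lerBlDl expR_ge1Dx.
Qed.

(** Sum the bounds of the shells [2^k eps <= |Y| <= 2^(k + 1) eps]. *)
Lemma SaS_char_markov (Y : Omega -> R) (alpha s eps : R) : 0 < alpha ->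
  measurable_fun setT Y -> 0 <= s -> SaS_char P alpha s Y -> 0 < eps ->
  (P [set w | (eps <= `|Y w|)%R] <=
     (markov_const alpha * (eps^-1 `^ alpha * s))%:E)%E.
Proof.
move=> a0 mY s0 cY e0.
have mn : measurable_fun setT (fun w => `|Y w|).
  exact: (measurableT_comp (@normr_measurable R setT) mY).
have e2 k : 0 < eps * 2 ^+ k by rewrite mulr_gt0// exprn_gt0.
pose F k := [set w | (eps * 2 ^+ k <= `|Y w| <= 2 * (eps * 2 ^+ k))%R].
have mF k : measurable (F k).
  rewrite (_ : F k = (fun w => `|Y w|) @^-1` `[eps * 2 ^+ k, 2 * (eps * 2 ^+ k)]); last first.
    by apply/seteqP; split => w /=; rewrite in_itv.
  rewrite -[X in measurable X]setTI.
  by apply: mn => //; exact: measurable_itv.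
have mA := measurable_exceed eps mY.
have AF : [set w | (eps <= `|Y w|)%R] `<=` \bigcup_k F k.
  move=> w /=; rewrite le_eqVlt => /predU1P[ew|/(dyadic_up e0)[n /andP[nl nu]]].
    exists 0%N => //=; rewrite /F/= expr0 mulr1 -ew lexx/=.
    by rewrite mulr_natl mulr2n lerDl ltW.
  exists n => //; rewrite /F/=; rewrite exprVn in nl nu.
  rewrite ltr_pdivlMr ?exprn_gt0// in nl; rewrite ler_pdivrMr ?exprn_gt0// in nu.
  by rewrite (ltW nl)/= (le_trans nu)// mulrA [2 * eps]mulrC.
have sub := @measure_sigma_subadditive _ _ _ P _ _ mF mA AF.
apply: (le_trans sub); pose c : R := (1 - cos 1)^-1 * (eps^-1 `^ alpha * s).
have c0 : 0 <= c.
  by rewrite mulr_ge0 ?invr_ge0 ?subr_ge0 ?cos_le1// mulr_ge0 ?powR_ge0.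
apply: (@le_trans _ _ (\sum_(k <oo) (c * (2^-1 `^ alpha) ^+ k)%:E)%E).
  apply: lee_nneseries => [k _ _|k _]; first exact: measure_ge0.
  apply: le_trans (SaS_char_shell mY s0 cY (e2 k)) _.
  rewrite lee_fin /c invfM powRM ?invr_ge0 ?exprn_ge0 ?(ltW e0)//.
  rewrite -exprVn -(powR_mulrn k (_ : 0 <= 2^-1))// powRAC powR_mulrn ?powR_ge0//.
  by rewrite -!mulrA [s * _]mulrC.
rewrite (_ : limn _ = (c * (1 - 2^-1 `^ alpha)^-1)%:E).
  rewrite lee_fin /c /markov_const invfM mulrAC -!mulrA; lra.
apply: cvg_lim => //.
rewrite (_ : (fun n => _) = EFin \o series (geometric c (2^-1 `^ alpha))); last first.
  by apply/funext => n /=; rewrite /series/= -sumEFin.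
apply: cvg_EFin; first exact: nearW.
by apply: cvg_geometric_series; rewrite ger0_norm ?powR_ge0// powR_inv2_lt1.
Qed.

End weak_markov.

(** * Stable integrals of simple functions *)

Section random_measure.
Context {R : realType} {dO : measure_display} {Omega : measurableType dO}.
Variable P : probability Omega R.
Context {d : nat}.
Notation leb := (@lebesgue_cV R d).
Variables (alpha : R) (Z : set 'cV[R]_d -> {RV P >-> R}).
Hypothesis alpha_gt0 : 0 < alpha.
Hypothesis hZ : SaS_random_measure alpha Z.

Lemma random_measure_char A : finite_borel A ->
  SaS_char P alpha (fine (leb A)) (Z A).
Proof.
move=> fA t; have [lawZ _ _] := hZ; have := lawZ A fA t.
by rewrite !unlock.
Qed.

Lemma finite_borel0 : finite_borel (set0 : set 'cV[R]_d).
Proof. by split => //; rewrite measure0 ltry. Qed.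

(** The partial sums of the series of which all terms are [Z set0] converge, so
its terms tend to 0. *)
Lemma random_measure0 : {ae P, forall w, Z set0 w = 0}.
Proof.
have [_ _ addZ] := hZ.
have U0 : \bigcup_(k : nat) (set0 : set 'cV[R]_d) = set0 by exact: bigcup0.
have := addZ (fun=> set0) (fun=> finite_borel0).
rewrite U0 => /(_ (@trivIset_set0 _ _ _) finite_borel0).
apply: filterS => w /cvgP/cvg_series_cvg_0 Z0.
by have := cvg_lim (@Rhausdorff R) Z0; rewrite lim_cst; [apply|exact: Rhausdorff].
Qed.

(** A finite family is padded with empty sets to a sequence. *)
Lemma random_measure_additive (J : finType) (A : J -> set 'cV[R]_d) :
  (forall j, finite_borel (A j)) -> trivIset setT A ->
  finite_borel (\bigcup_j A j) ->
  {ae P, forall w, Z (\bigcup_j A j) w = \sum_j Z (A j) w}.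
Proof.
move=> fA tA fU; have [_ _ addZ] := hZ.
pose B k := if insub k is Some i then A (@enum_val J xpredT i) else set0.
have BE (i : 'I_#|J|) : B i = A (enum_val i) by rewrite /B valK.
have B0 k : (#|J| <= k)%N -> B k = set0.
  by move=> nk; rewrite /B insubN// -leqNgt.
have fB k : finite_borel (B k).
  by rewrite /B; case: insubP => [i _ _|_]; [exact: fA|exact: finite_borel0].
have UB : \bigcup_k B k = \bigcup_j A j.
  apply/seteqP; split => [x [k _]|x [j _ Ajx]].
    by rewrite /B; case: insubP => // i _ _ Ax; exists (enum_val i).
  by exists (enum_rank j) => //; rewrite BE enum_rankK.
have tB : trivIset setT B.
  apply/trivIsetP => k l _ _ kl; rewrite /B.
  case: insubP => [i _ ik|_]; last by rewrite set0I.
  case: insubP => [j _ jl|_]; last by rewrite setI0.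
  move/trivIsetP : tA; apply => //; apply: contra_neq kl => /enum_val_inj ij.
  by rewrite -ik -jl ij.
have := addZ B fB tB; rewrite UB => /(_ fU) addB.
apply: filterS2 random_measure0 addB => w Z0 cw.
rewrite -(cvg_lim (@Rhausdorff R) cw).
apply: (cvg_lim (@Rhausdorff R)); apply: cvg_near_cst.
exists #|J| => // n /= nJ; rewrite /series/=.
rewrite (big_cat_nat (n := #|J|))//= [X in _ + X]big1_seq ?addr0; last first.
  by move=> k; rewrite mem_index_iota => /and3P[_ Jk _]; rewrite B0.
rewrite big_mkord [RHS]big_enum_val/=.
by apply: eq_bigr => i _; rewrite BE.
Qed.

Lemma finite_borelS A B : finite_borel B -> measurable A -> A `<=` B ->
  finite_borel (A : set 'cV[R]_d).
Proof.
move=> [mB Boo] mA AB; split => //; apply: le_lt_trans Boo.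
by apply: le_measure; rewrite ?inE.
Qed.

Lemma random_measure_char_sum (J : finType) (A : J -> set 'cV[R]_d) (a : J -> R) :
  (forall j, finite_borel (A j)) -> trivIset setT A ->
  SaS_char P alpha (\sum_j `|a j| `^ alpha * fine (leb (A j)))
    (fun w => \sum_j a j * Z (A j) w).
Proof.
move=> fA tA; have [_ indZ _] := hZ.
have := @SaS_char_sum _ _ _ P #|J| (fun i => Z (A (enum_val i)))
  (fun i => a (enum_val i)) (fun i => fine (leb (A (enum_val i)))) alpha.
have sumE (F : J -> R) : \sum_(i < #|J|) F (enum_val i) = \sum_j F j.
  by rewrite [RHS]big_enum_val.
rewrite (sumE (fun j => `|a j| `^ alpha * fine (leb (A j)))).
rewrite (_ : (fun w => _) = (fun w => \sum_j a j * Z (A j) w)); last first.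
  by apply/funext => w; rewrite (sumE (fun j => a j * Z (A j) w)).
apply; last by move=> i; exact: random_measure_char.
apply: indZ => //; apply/trivIsetP => i j _ _ ij.
move/trivIsetP : tA; apply => //; apply: contra_neq ij; exact: enum_val_inj.
Qed.

Lemma measurable_level (f : {sfun 'cV[R]_d >-> R}) c : measurable (f @^-1` [set c]).
Proof. exact: measurable_funPTI. Qed.

Lemma Lalpha_level (f : {sfun 'cV[R]_d >-> R}) c : Lalpha alpha f -> c != 0 ->
  finite_borel (f @^-1` [set c]).
Proof.
move=> [mf foo] c0; have mA := measurable_level f c; split => //.
have ca : 0 < `|c| `^ alpha by rewrite powR_gt0// normr_gt0.
have : ((`|c| `^ alpha)%:E * leb (f @^-1` [set c]) < +oo)%E.
  apply: le_lt_trans foo.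
  rewrite -[X in leb X]setIT -integral_indic// -ge0_integralZl_EFin ?(ltW ca)//.
    apply: ge0_le_integral => //.
    - by apply: measurable_funeM; apply/measurable_EFinP/measurable_indic.
    - apply/measurable_EFinP/(measurableT_comp (measurable_powR _)).
      exact: (measurableT_comp (@normr_measurable R setT)).
    - move=> x _; rewrite -EFinM lee_fin indicE.
      case: (boolP (x \in _)) => [/set_mem/= ->|_]; first by rewrite mulr1.
      by rewrite mulr0 powR_ge0.
  exact/measurable_EFinP/measurable_indic.
by have [->|] := eqVneq (leb (f @^-1` [set c])) +oo%E; rewrite ?gt0_muley ?lte_fin// -ltey.
Qed.

Lemma sfun_in_range (f : {sfun 'cV[R]_d >-> R}) x : f x \in fset_set (range f).
Proof. by rewrite in_fset_set//; apply/mem_set; exists x. Qed.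

Lemma simple_integralE (f : {sfun 'cV[R]_d >-> R}) w : simple_integral Z f w =
  \sum_(c : fset_set (range f)) fsval c * Z (f @^-1` [set fsval c]) w.
Proof.
rewrite /simple_integral fsbig_finite//=.
by rewrite (big_seq_fsetE _ _ xpredT (fun c => c * Z (f @^-1` [set c]) w)).
Qed.

Lemma measurable_simple_integral (f : {sfun 'cV[R]_d >-> R}) :
  measurable_fun setT (simple_integral Z f).
Proof.
rewrite (_ : simple_integral Z f = (fun w =>
  \sum_(c : fset_set (range f)) fsval c * Z (f @^-1` [set fsval c]) w)).
  by apply: measurable_sum => c; apply: measurable_funM.
by apply/funext => w; exact: simple_integralE.
Qed.

(** Two simple functions are compared on the common refinement of their level
sets. The identity is only almost sure because the additivity of [Z] is. *)
Lemma simple_integral_refine (f g : {sfun 'cV[R]_d >-> R}) : Lalpha alpha f ->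
  {ae P, forall w, simple_integral Z f w =
    \sum_(c : fset_set (range f)) \sum_(e : fset_set (range g))
      fsval c * Z (f @^-1` [set fsval c] `&` g @^-1` [set fsval e]) w}.
Proof.
move=> Lf.
pose A (c : fset_set (range f)) (e : fset_set (range g)) :=
  f @^-1` [set fsval c] `&` g @^-1` [set fsval e].
have mA c e : measurable (A c e) by apply: measurableI; exact: measurable_level.
have tA c : trivIset setT (A c).
  apply/trivIsetP => e e' _ _ ee'; apply/seteqP; split => // x [[_ /= xe] [_ /= xe']].
  by case/eqP: ee'; apply/val_inj; rewrite /= -xe -xe'.
have UA c : \bigcup_e A c e = f @^-1` [set fsval c].
  apply/seteqP; split => [x [e _ []//]|x xc].
  by exists [` sfun_in_range g x]%fset.
have aeA c : {ae P, forall w,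
    fsval c * Z (f @^-1` [set fsval c]) w = \sum_e fsval c * Z (A c e) w}.
  have [c0|c0] := eqVneq (fsval c) 0.
    apply: nearW => w; rewrite c0 mul0r big1// => e _; by rewrite mul0r.
  have fc := Lalpha_level Lf c0.
  have fA e : finite_borel (A c e) by apply: (finite_borelS fc) => // x [].
  have fU : finite_borel (\bigcup_e A c e) by rewrite UA.
  have := random_measure_additive fA (tA c) fU; rewrite UA.
  by apply: filterS => w ->; rewrite mulr_sumr.
have : {ae P, forall w, forall c,
    fsval c * Z (f @^-1` [set fsval c]) w = \sum_e fsval c * Z (A c e) w}.
  by apply: filter_forall => c; exact: aeA.
by apply: filterS => w H; rewrite simple_integralE; apply: eq_bigr => c _; exact: H.
Qed.

Section simple_difference.
Variables f g : {sfun 'cV[R]_d >-> R}.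
Hypotheses (Lf : Lalpha alpha f) (Lg : Lalpha alpha g).

Let J : finType := (fset_set (range f) * fset_set (range g))%type.

Let coef (p : J) : R := fsval p.1 - fsval p.2.

(** Where the two functions agree they do not contribute; these pieces are emptied
because one of them, where both functions are 0, has infinite measure in general. *)
Let piece (p : J) := if fsval p.1 == fsval p.2 then set0 else
  f @^-1` [set fsval p.1] `&` g @^-1` [set fsval p.2].

Let mpiece p : measurable (piece p).
Proof. by rewrite /piece; case: ifP => // _; apply: measurableI; exact: measurable_level. Qed.

Let fpiece p : finite_borel (piece p).
Proof.
rewrite /piece; case: ifPn => [_|ce]; first exact: finite_borel0.
have mI : measurable (f @^-1` [set fsval p.1] `&` g @^-1` [set fsval p.2]).
  by apply: measurableI; exact: measurable_level.
have [c0|c0] := eqVneq (fsval p.1) 0.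
  apply: (finite_borelS (Lalpha_level Lg _) mI) => //.
  by apply: contra ce => /eqP e0; rewrite c0 e0.
exact: (finite_borelS (Lalpha_level Lf c0) mI).
Qed.

Let tpiece : trivIset setT piece.
Proof.
apply/trivIsetP => p q _ _ pq; apply/seteqP; split => // x [].
rewrite /piece; case: ifP => // _ [/= xp1 xp2]; case: ifP => // _ [/= xq1 xq2].
case/eqP: pq; case: p q xp1 xp2 xq1 xq2 => [p1 p2] [q1 q2] /= xp1 xp2 xq1 xq2.
by congr pair; apply/val_inj; rewrite /= -?xp1 -?xp2.
Qed.

Let simple_difference :
  {ae P, forall w, simple_integral Z f w - simple_integral Z g w =
    \sum_p coef p * Z (piece p) w}.
Proof.
apply: filterS2 (simple_integral_refine g Lf) (simple_integral_refine f Lg) => w -> ->.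
rewrite [X in _ - X]exchange_big/= -sumrB.
transitivity (\sum_(c : fset_set (range f)) \sum_(e : fset_set (range g))
    (fsval c * Z (f @^-1` [set fsval c] `&` g @^-1` [set fsval e]) w -
     fsval e * Z (g @^-1` [set fsval e] `&` f @^-1` [set fsval c]) w)).
  by apply: eq_bigr => c _; rewrite sumrB.
rewrite pair_bigA/=; apply: eq_bigr => p _.
rewrite [X in _ - _ * Z X w]setIC -mulrBl /coef /piece.
by case: eqP => [->|//]; rewrite subrr !mul0r.
Qed.

Let integral_difference :
  (\int[leb]_y (`|f y - g y| `^ alpha)%:E)%E =
  (\sum_p `|coef p| `^ alpha * fine (leb (piece p)))%:E.
Proof.
pose h p y := `|coef p| `^ alpha * \1_(piece p) y.
transitivity (\int[leb]_y (\sum_p (h p y)%:E))%E.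
  apply: eq_integral => y _; rewrite sumEFin; congr EFin.
  pose p0 : J := ([` sfun_in_range f y]%fset, [` sfun_in_range g y]%fset).
  rewrite (bigD1 p0)//= big1 ?addr0.
    rewrite /h /coef /= /piece /= indicE; case: ifPn => [/eqP ->|_].
      by rewrite subrr normr0 powR0 ?gt_eqF// mul0r.
    by rewrite mem_set ?mulr1.
  move=> p pp0; rewrite /h indicE memNset ?mulr0// /piece; case: ifP => [_ []|_ [/= yp1 yp2]].
  by case/eqP: pp0; case: p yp1 yp2 => [p1 p2] /= yp1 yp2; congr pair; exact/val_inj.
have h0 p y : 0 <= h p y by rewrite mulr_ge0 ?powR_ge0// indicE.
have mh p : measurable_fun setT (h p).
  by apply: measurable_funM => //; exact: measurable_indic.
rewrite ge0_integral_sum//; last 2 first.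
- by move=> p; exact/measurable_EFinP.
- by move=> p y _; rewrite lee_fin.
rewrite -sumEFin; apply: eq_bigr => p _; rewrite /h.
under eq_integral do rewrite EFinM.
rewrite ge0_integralZl_EFin ?powR_ge0//; last first.
  exact/measurable_EFinP/measurable_indic.
rewrite integral_indic// setIT EFinM fineK// ge0_fin_numE//.
by have [] := fpiece p.
Qed.

(** The difference of the integrals is almost surely a linear combination of the
values of [Z] on disjoint sets, whose characteristic function is explicit. *)
Lemma simple_integral_dist (eps : R) : 0 < eps ->
  (P [set w | (eps <= `|simple_integral Z f w - simple_integral Z g w|)%R] <=
   (markov_const alpha * eps^-1 `^ alpha)%:E *
     \int[leb]_y (`|f y - g y| `^ alpha)%:E)%E.
Proof.
move=> e0; rewrite integral_difference.
set S := \sum_p _.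
have S0 : 0 <= S by apply: sumr_ge0 => p _; rewrite mulr_ge0 ?powR_ge0// fine_ge0.
have cS := random_measure_char_sum coef fpiece tpiece.
pose Y w := \sum_p coef p * Z (piece p) w.
have mY : measurable_fun setT Y.
  by apply: measurable_sum => p; apply: measurable_funM.
rewrite -EFinM -mulrA.
apply: le_trans (SaS_char_markov alpha_gt0 mY S0 cS e0).
have [N [mN PN0 subN]] := simple_difference.
have mYe := measurable_exceed eps mY.
have mDe := measurable_exceed eps (measurable_funB (measurable_simple_integral f)
  (measurable_simple_integral g)).
apply: (@le_trans _ _ (P ([set w | (eps <= `|Y w|)%R] `|` N))).
  apply: le_measure; rewrite ?inE//; first exact: measurableU.
  move=> w /= we; have [Nw|Nw] := pselect (N w); [by right|left].
  have : simple_integral Z f w - simple_integral Z g w = Y w.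
    by apply: contrapT => H; apply: Nw; apply: subN.
  by move=> <-.
rewrite (le_trans (measureU2 _ _ _))//= PN0 adde0//.
Qed.

End simple_difference.

End random_measure.

(** * Approximation in L^alpha and convergence in probability *)

Section power_integrals.
Context {R : realType} {d : nat}.
Notation leb := (@lebesgue_cV R d).
Variable alpha : R.
Hypothesis alpha_gt0 : 0 < alpha.

(** The [alpha]-th power of the L^alpha distance, which makes sense for [alpha < 1]
as well; the triangle inequality holds up to a factor. *)
Definition dist_pow (f g : 'cV[R]_d -> R) : \bar R :=
  (\int[leb]_y (`|f y - g y| `^ alpha)%:E)%E.

Lemma dist_pow_ge0 f g : (0 <= dist_pow f g)%E.
Proof. by apply: integral_ge0 => y _; rewrite lee_fin powR_ge0. Qed.

Lemma dist_powC f g : dist_pow f g = dist_pow g f.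
Proof. by apply: eq_integral => y _; rewrite distrC. Qed.

Lemma measurable_powR_norm d' (T : measurableType d') (f : T -> R) :
  measurable_fun setT f -> measurable_fun setT (fun y => (`|f y| `^ alpha)%:E).
Proof.
move=> mf; apply/measurable_EFinP.
apply: (measurableT_comp (measurable_powR alpha)).
exact: (measurableT_comp (@normr_measurable R setT)).
Qed.

Lemma dist_pow_triangle f g h : measurable_fun setT f -> measurable_fun setT g ->
  measurable_fun setT h ->
  (dist_pow f h <= (2 `^ alpha)%:E * (dist_pow f g + dist_pow g h))%E.
Proof.
move=> mf mg mh.
have mfg := measurable_powR_norm (measurable_funB mf mg).
have mgh := measurable_powR_norm (measurable_funB mg mh).
have mfh := measurable_powR_norm (measurable_funB mf mh).
have ge0 (u : 'cV[R]_d -> R) y : setT y -> (0 <= (`|u y| `^ alpha)%:E)%E.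
  by rewrite lee_fin powR_ge0.
rewrite /dist_pow -ge0_integralD//; try exact: (ge0 (fun y => _ - _)).
rewrite -ge0_integralZl_EFin ?powR_ge0//; last first.
- exact: emeasurable_funD.
- by move=> y _; rewrite -EFinD lee_fin addr_ge0 ?powR_ge0.
apply: ge0_le_integral => //.
- by apply: measurable_funeM; exact: emeasurable_funD.
- move=> y _; rewrite -EFinD -EFinM lee_fin.
  by have := powR_normD_le alpha_gt0 (f y - g y) (g y - h y); rewrite addrA subrK.
Qed.

Lemma dist_pow_le_add f g h (a b : R) : measurable_fun setT f ->
  measurable_fun setT g -> measurable_fun setT h ->
  (dist_pow f g <= a%:E)%E -> (dist_pow g h <= b%:E)%E ->
  (dist_pow f h <= (2 `^ alpha * (a + b))%:E)%E.
Proof.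
move=> mf mg mh fg gh; apply: (le_trans (dist_pow_triangle mf mg mh)).
rewrite EFinM EFinD; apply: lee_wpmul2l; first by rewrite lee_fin powR_ge0.
exact: leeD.
Qed.

Import HBNNSimple.

(** The monotone approximations of the positive and the negative part converge
pointwise, and [|f|^alpha] dominates: dominated convergence. *)
Lemma simple_dense (f : 'cV[R]_d -> R) (e : R) : Lalpha alpha f -> 0 < e ->
  exists h : {sfun 'cV[R]_d >-> R}, Lalpha alpha h /\ (dist_pow h f <= e%:E)%E.
Proof.
move=> [mf foo] e0.
pose fp y := Num.max (f y) 0; pose fm y := Num.max (- f y) 0.
have mfp : measurable_fun setT (EFin \o fp).
  by apply/measurable_EFinP; exact: measurable_funrpos.
have mfm : measurable_fun setT (EFin \o fm).
  by apply/measurable_EFinP; exact: measurable_funrneg.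
have fp0 y : setT y -> (0 <= (EFin \o fp) y)%E by rewrite lee_fin le_max lexx orbT.
have fm0 y : setT y -> (0 <= (EFin \o fm) y)%E by rewrite lee_fin le_max lexx orbT.
pose gp := nnsfun_approx measurableT mfp; pose gm := nnsfun_approx measurableT mfm.
pose h n : {sfun 'cV[R]_d >-> R} := (gp n \+ cst (-1) \* gm n).
have hE n y : h n y = gp n y - gm n y by rewrite /h/= mulN1r.
have gple n y : gp n y <= fp y.
  by have := le_approx n fp0 (Logic.I : setT y); rewrite /gp nnsfun_approxE lee_fin.
have gmle n y : gm n y <= fm y.
  by have := le_approx n fm0 (Logic.I : setT y); rewrite /gm nnsfun_approxE lee_fin.
have gp0 n y : 0 <= gp n y by [].
have gm0 n y : 0 <= gm n y by [].
have fE y : f y = fp y - fm y /\ `|f y| = fp y + fm y.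
  rewrite /fp /fm; have [f0|] := boolP (0 <= f y); last rewrite -ltNge => f0.
    by rewrite max_l// max_r ?oppr_le0// subr0 addr0 ger0_norm.
  by rewrite max_r ?(ltW f0)// max_l ?oppr_ge0 ?(ltW f0)// opprK sub0r add0r ltr0_norm// opprK.
have hle n y : `|h n y| <= `|f y|.
  rewrite hE (fE y).2 (le_trans (ler_normB _ _))// lerD// ger0_norm//.
have hfle n y : `|h n y - f y| <= `|f y|.
  rewrite hE (fE y).2 {1}(fE y).1; have := gple n y; have := gmle n y.
  have := gp0 n y; have := gm0 n y.
  by move=> ? ? ? ?; rewrite ler_norml; apply/andP; split; lra.
have mh n : measurable_fun setT (h n) by exact: measurable_funP.
have Lh n : Lalpha alpha (h n).
  split; first exact: mh.
  apply: le_lt_trans foo; apply: ge0_le_integral => //.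
  - exact: measurable_powR_norm.
  - exact: measurable_powR_norm.
  - by move=> y _; rewrite lee_fin ge0_ler_powR ?nnegrE// ltW.
have intf : leb.-integrable setT (fun y => (`|f y| `^ alpha)%:E).
  apply/integrableP; split; first exact: measurable_powR_norm.
  rewrite (eq_integral (fun y => (`|f y| `^ alpha)%:E))// => y _.
  by rewrite /= ger0_norm ?powR_ge0.
have cvgh y : h ^~ y @ \oo --> f y.
  rewrite (fE y).1 (_ : h ^~ y = (fun n => gp n y - gm n y)); last first.
    by apply/funext => n; exact: hE.
  have cp : gp ^~ y @ \oo --> fp y.
    exact: (fine_cvg (cvg_nnsfun_approx measurableT mfp fp0 (Logic.I : setT y))).
  have cm : gm ^~ y @ \oo --> fm y.
    exact: (fine_cvg (cvg_nnsfun_approx measurableT mfm fm0 (Logic.I : setT y))).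
  exact: cvgB.
pose D n y : \bar R := (`|h n y - f y| `^ alpha)%:E.
have mD n : measurable_fun setT (D n).
  by apply: measurable_powR_norm; exact: measurable_funB.
have D0 : (fun n => \int[leb]_y D n y)%E @ \oo --> 0%E.
  have Dcvg : {ae leb, forall y, setT y -> D ^~ y @ \oo --> (cst 0%E : 'cV[R]_d -> \bar R) y}.
    apply: aeW => y _; apply: cvg_EFin; first exact: nearW.
    apply: powR_cvg0_comp => //; apply/norm_cvg0P.
    by rewrite -(subrr (f y)); apply: cvgB => //; exact: cvg_cst.
  have Dle : {ae leb, forall y n, setT y -> (`|D n y| <= (`|f y| `^ alpha)%:E)%E}.
    apply: aeW => y n _; rewrite /D /= lee_fin ger0_norm ?powR_ge0//.
    by rewrite ge0_ler_powR ?nnegrE ?(ltW alpha_gt0)//; exact: hfle.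
  have [_ _] := dominated_convergence measurableT mD (measurable_cst _) Dcvg intf Dle.
  by rewrite integral0.
have [n _ nP] : \forall n \near \oo, (\int[leb]_y D n y < e%:E)%E.
  exact: ereal_cvg0_lt D0 e0.
by exists (h n); split; [exact: Lh|apply/ltW/(nP n) => /=].
Qed.

End power_integrals.

Section convergence_in_probability.
Context {R : realType} {dO : measure_display} {Omega : measurableType dO}.
Variable P : probability Omega R.

(** Borel-Cantelli. Outside [B n], an event of probability at most [2 * 2^(- n)],
the sequence is Cauchy with an explicit rate from rank [n] on. The limit is
defined everywhere, and measurably, as an upper limit. *)
Lemma probability_complete (Y : nat -> Omega -> R) :
  (forall n, measurable_fun setT (Y n)) ->
  (forall k, (P [set w | (2^-1 ^+ k <= `|Y k w - Y k.+1 w|)%R] <= (2^-1 ^+ k)%:E)%E) ->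
  exists Yoo : {RV P >-> R}, cvg_in_prob P \oo Y Yoo.
Proof.
move=> mY YP.
pose L w := fine (limn_esup (fun n => (Y n w)%:E)).
have mL : measurable_fun setT L.
  apply: measurableT_comp; first exact: fine_measurable.
  apply: (@measurable_fun_limn_esup _ _ _ _ (fun n w => (Y n w)%:E)) => n.
  exact/measurable_EFinP.
pose L' : {mfun Omega >-> R} := HB.pack L (@isMeasurableFun.Build _ _ Omega R L mL).
exists L' => eps e0.
pose F k := [set w | 2^-1 ^+ k <= `|Y k w - Y k.+1 w|].
have mF k : measurable (F k) by apply: measurable_exceed; exact: measurable_funB.
pose B n := \bigcup_k F (n + k)%N.
have mB n : measurable (B n) by apply: bigcup_measurable.
have PB n : (P (B n) <= (2 * 2^-1 ^+ n)%:E)%E.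
  have sub := @measure_sigma_subadditive _ _ _ P _ (fun k => F (n + k)%N)
    (fun k => mF _) (mB n) (@subset_refl _ _).
  apply: (le_trans sub).
  apply: (@le_trans _ _ (\sum_(k <oo) (geometric (2^-1 ^+ n) 2^-1 k)%:E)%E).
    apply: lee_nneseries => [k _ _|k _]; first exact: measure_ge0.
    by rewrite /geometric /= -exprD; exact: YP.
  rewrite (_ : limn _ = (2 * 2^-1 ^+ n)%:E)//.
  apply: cvg_lim => //.
  rewrite (_ : (fun m => _) = EFin \o series (geometric (2^-1 ^+ n) 2^-1)); last first.
    by apply/funext => m /=; rewrite /series/= -sumEFin.
  apply: cvg_EFin; first exact: nearW.
  have -> : 2 * 2^-1 ^+ n = 2^-1 ^+ n * (1 - 2^-1)^-1 :> R by field.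
  by apply: cvg_geometric_series; rewrite ger0_norm ?invr_ge0// invf_lt1// ltr1n.
have incl n : 2 * 2^-1 ^+ n < eps -> [set w | eps <= `|Y n w - L w|] `<=` B n.
  move=> ne w /= we; apply: contrapT => nB.
  have Yn k : (n <= k)%N -> `|Y k w - Y k.+1 w| <= 2^-1 ^+ k.
    move=> nk; rewrite leNgt; apply/negP => kF; apply: nB.
    by exists (k - n)%N => //; rewrite /F/= subnKC// ltW.
  have [l Yl lP] := geometric_cauchy Yn.
  have Lw : L w = l.
    have c : (fun n => (Y n w)%:E) @ \oo --> l%:E by apply: cvg_EFin; first exact: nearW.
    rewrite /L is_cvg_limn_esupE; last exact/cvgP/c.
    by rewrite (cvg_lim _ c).
  by move: we; rewrite Lw leNgt (le_lt_trans (lP n (leqnn n))).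
apply: ereal_cvg0 => [n|e e0']; first exact: measure_ge0.
have [n1 n1P] := geometric_small e0.
have [n2 n2P] := geometric_small e0'.
exists (maxn n1 n2) => // n /=; rewrite geq_max => /andP[n1n n2n].
apply: (le_trans (le_measure P _ _ (incl _ (n1P _ n1n)))); rewrite ?inE//.
  by apply: measurable_exceed; exact: measurable_funB.
by rewrite (le_trans (PB n))// lee_fin ltW// n2P.
Qed.

End convergence_in_probability.

(** * Stable integrals *)

Section stable_integrals.
Context {R : realType} {dO : measure_display} {Omega : measurableType dO}.
Variable P : probability Omega R.
Context {d : nat}.
Notation leb := (@lebesgue_cV R d).
Variables (alpha : R) (Z : set 'cV[R]_d -> {RV P >-> R}).
Hypothesis alpha_gt0 : 0 < alpha.
Hypothesis hZ : SaS_random_measure alpha Z.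

Let K := markov_const alpha.
Let T : R := 2 `^ alpha.

Let K_gt0 : 0 < K. Proof. exact: markov_const_gt0. Qed.
Let T_gt0 : 0 < T. Proof. exact: powR_gt0. Qed.

(** Simple approximations of [f] converging fast enough in L^alpha have integrals
that satisfy the hypothesis of [probability_complete]. *)
Lemma stable_integral_existence f : Lalpha alpha f ->
  stable_integral_exists alpha Z f.
Proof.
move=> Lf.
(* Chosen so that the bound of [simple_integral_dist] with [eps = 2^(- k)], applied
   to two consecutive approximations, equals [2^(- k)]. *)
pose del k : R := 2^-1 ^+ k * (2^-1 ^+ k) `^ alpha / (2 * T * K).
have TK0 : 0 < 2 * T * K by rewrite !mulr_gt0.
have pw0 k : 0 < (2^-1 : R) ^+ k by rewrite exprn_gt0 ?invr_gt0.
have del0 k : 0 < del k by rewrite divr_gt0// mulr_gt0// powR_gt0.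
have pwS k : (2^-1 : R) ^+ k.+1 <= 2^-1 ^+ k.
  by rewrite exprS ger_pMl// invf_le1// ler1n.
have delS k : del k.+1 <= del k.
  rewrite ler_pM2r ?invr_gt0// ler_pM ?powR_ge0 ?(ltW (pw0 _))//.
  by rewrite ge0_ler_powR// ?nnegrE ltW.
have /choice[h hP] : forall k, exists h : {sfun 'cV[R]_d >-> R},
    Lalpha alpha h /\ (dist_pow alpha h f <= (del k)%:E)%E.
  by move=> k; exact: simple_dense.
have Lh k := (hP k).1; have dh k := (hP k).2.
have mf := Lf.1.
have step k : (P [set w | (2^-1 ^+ k <=
    `|simple_integral Z (h k) w - simple_integral Z (h k.+1) w|)%R] <= (2^-1 ^+ k)%:E)%E.
  apply: (le_trans (simple_integral_dist alpha_gt0 hZ (Lh k) (Lh k.+1) (pw0 k))).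
  have A0 : 0 < (2^-1 ^+ k)^-1 `^ alpha :> R by rewrite powR_gt0// invr_gt0.
  apply: (@le_trans _ _ ((K * (2^-1 ^+ k)^-1 `^ alpha)%:E * (T * (del k + del k))%:E)%E).
    rewrite lee_pmul2l ?lte_fin ?mulr_gt0//.
    apply: (dist_pow_le_add alpha_gt0 (Lh k).1 mf (Lh k.+1).1 (dh k)).
    by rewrite dist_powC (le_trans (dh _))// lee_fin.
  rewrite -EFinM lee_fin le_eqVlt; apply/orP; left; apply/eqP.
  have AB : (2^-1 ^+ k)^-1 `^ alpha * (2^-1 ^+ k) `^ alpha = 1 :> R.
    by rewrite -powRM ?invr_ge0 ?(ltW (pw0 k))// mulVf ?powR1// gt_eqF.
  rewrite /del; transitivity (2^-1 ^+ k * ((2^-1 ^+ k)^-1 `^ alpha * (2^-1 ^+ k) `^ alpha) : R).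
    by field; rewrite !gt_eqF.
  by rewrite AB mulr1.
have [Y YP] := probability_complete (fun k => measurable_simple_integral Z (h k)) step.
exists Y; split => //; exists h; split => //.
apply: ereal_cvg0 => [n|e e0]; first exact: dist_pow_ge0.
have [n0 n0P] := geometric_small (mulr_gt0 e0 TK0).
exists n0 => // n /= nn; apply: (le_trans (dh n)); rewrite lee_fin.
rewrite /del ler_pdivrMr// (le_trans _ (ltW (n0P _ nn)))//.
have pw1 : (2^-1 ^+ n) `^ alpha <= 1 :> R.
  have pn1 : (2^-1 : R) ^+ n <= 1 by rewrite exprn_ile1// invf_le1// ler1n.
  by have := ge0_ler_powR (ltW alpha_gt0) (ltW (pw0 n)) ler01 pn1; rewrite powR1.
rewrite (le_trans (ler_wpM2l (ltW (pw0 n)) pw1))// mulr1.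
by rewrite ler_peMl ?ler1n// ltW.
Qed.

(** The bound for simple functions passes to the limit: [eps] is shared between
the distances of the two integrals to their approximations and the distance of the
approximations, and the quasi-triangle inequality of [dist_pow] is used twice. *)
Lemma stable_integral_dist f g (Y Y' : {RV P >-> R}) eps : 0 < eps ->
  is_stable_integral alpha Z f Y -> is_stable_integral alpha Z g Y' ->
  (P [set w | (eps <= `|Y w - Y' w|)%R] <=
    (K * (eps / 3)^-1 `^ alpha * (T * T))%:E * dist_pow alpha f g)%E.
Proof.
move=> e0 [Lf [fn [Lfn dfn Yfn]]] [Lg [gn [Lgn dgn Ygn]]].
have e30 : 0 < eps / 3 by rewrite divr_gt0.
set C := K * _.
have C0 : 0 < C by rewrite mulr_gt0// powR_gt0// invr_gt0.
have := dist_pow_ge0 alpha f g.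
case D : (dist_pow alpha f g) => [r||]// r0; last first.
  have CT : 0 < C * (T * T) by exact: (mulr_gt0 C0 (mulr_gt0 T_gt0 T_gt0)).
  by rewrite gt0_muley ?lte_fin// leey.
rewrite lee_fin in r0.
apply/lee_addgt0Pr => e e_gt0.
pose e2 := e / (2 * (C * (T + T * T))).
have TT0 : 0 < T + T * T := addr_gt0 T_gt0 (mulr_gt0 T_gt0 T_gt0).
have e20 : 0 < e2 := divr_gt0 e_gt0 (mulr_gt0 (ltr0Sn R 1) (mulr_gt0 C0 TT0)).
have e40 : 0 < e / 4 by rewrite divr_gt0.
have [n [[[n1 n2] n3] n4]] : exists n : nat,
    (((P [set w | (eps / 3 <= `|simple_integral Z (fn n) w - Y w|)%R] < (e / 4)%:E)%E /\
    (P [set w | (eps / 3 <= `|simple_integral Z (gn n) w - Y' w|)%R] < (e / 4)%:E)%E) /\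
    (dist_pow alpha (fn n) f < e2%:E)%E) /\ (dist_pow alpha (gn n) g < e2%:E)%E.
  apply: (@filter_ex _ \oo).
  have c1 := @ereal_cvg0_lt _ _ \oo eventually_filter _ _ (Yfn _ e30) e40.
  have c2 := @ereal_cvg0_lt _ _ \oo eventually_filter _ _ (Ygn _ e30) e40.
  have c3 := @ereal_cvg0_lt _ _ \oo eventually_filter _ _ dfn e20.
  have c4 := @ereal_cvg0_lt _ _ \oo eventually_filter _ _ dgn e20.
  exact: (filterI (filterI (filterI c1 c2) c3) c4).
pose F := [set w | eps / 3 <= `|simple_integral Z (fn n) w - Y w|].
pose G := [set w | eps / 3 <= `|simple_integral Z (gn n) w - Y' w|].
pose M := [set w | eps / 3 <= `|simple_integral Z (fn n) w - simple_integral Z (gn n) w|].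
have mS h := measurable_simple_integral Z h.
have mF : measurable F by apply: measurable_exceed; apply: measurable_funB.
have mG : measurable G by apply: measurable_exceed; apply: measurable_funB.
have mM : measurable M by apply: measurable_exceed; apply: measurable_funB.
have mY : measurable [set w | eps <= `|Y w - Y' w|].
  by apply: measurable_exceed; apply: measurable_funB.
have sub : [set w | eps <= `|Y w - Y' w|] `<=` (F `|` G) `|` M.
  move=> w /= we; apply: contrapT => /not_orP[/not_orP[]].
  rewrite /F /G /M /= => /negP; rewrite -ltNge => F1 /negP; rewrite -ltNge => G1.
  move=> /negP; rewrite -ltNge => M1.
  have : `|Y w - Y' w| < eps.
    rewrite (_ : Y w - Y' w = (simple_integral Z (gn n) w - Y' w) -
      (simple_integral Z (fn n) w - Y w) +
      (simple_integral Z (fn n) w - simple_integral Z (gn n) w)); last by ring.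
    rewrite (le_lt_trans (ler_normD _ _))// (le_lt_trans (lerD (ler_normB _ _) (lexx _)))//.
    lra.
  by rewrite ltNge we.
apply: (le_trans (le_measure P _ _ sub)); rewrite ?inE//.
  by do 2?apply: measurableU.
apply: (le_trans (measureU2 _ (measurableU _ _ mF mG) mM)).
have PM : (P M <= (C * (T * (e2 + T * (r + e2))))%:E)%E.
  apply: (le_trans (simple_integral_dist alpha_gt0 hZ (Lfn n) (Lgn n) e30)).
  rewrite [leRHS]EFinM; apply: lee_wpmul2l; first by rewrite lee_fin ltW.
  apply: (dist_pow_le_add alpha_gt0 (Lfn n).1 Lf.1 (Lgn n).1 (ltW n3)).
  apply: (dist_pow_le_add alpha_gt0 Lf.1 Lg.1 (Lgn n).1); first by rewrite D.
  by rewrite dist_powC; exact: ltW.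
apply: (@le_trans _ _ ((e / 4)%:E + (e / 4)%:E + (C * (T * (e2 + T * (r + e2))))%:E)%E).
  rewrite leeD// (le_trans (measureU2 _ mF mG))// leeD//; exact: ltW.
rewrite -!EFinD lee_fin.
have E2 : C * (T + T * T) * e2 = e / 2.
  by rewrite /e2; field; rewrite !gt_eqF// addr_gt0.
rewrite le_eqVlt; apply/orP; left; apply/eqP.
transitivity (e / 2 + (C * (T * T) * r + C * (T + T * T) * e2)); first by field.
by rewrite E2; field.
Qed.

End stable_integrals.

Theorem theorem3p1 (R : realType) (d : nat) (hd : (0 < d)%N)
    (E : 'M[R]_d) (hE : positive_spectrum E)
    (N0 : 'cV[R]_d -> R) (hN0 : adapted_norm E N0)
    (beta : R) (hbeta : 0 < beta)
    (phi : 'cV[R]_d -> R) (hphi_hom : homogeneous_fun E phi)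
    (hphi_adm : admissible_fun beta E N0 phi)
    (alpha : R) (halpha0 : 0 < alpha) (halpha2 : alpha <= 2)
    (H : R) (hH0 : 0 < H) (hHbeta : H < beta)
    (dO : measure_display) (Omega : measurableType dO)
    (P : probability Omega R)
    (Z : set 'cV[R]_d -> {RV P >-> R}) (hZ : SaS_random_measure alpha Z) :
  (forall x : 'cV[R]_d,
     stable_integral_exists alpha Z (ma_kernel E phi alpha H x)) /\
  (forall X : 'cV[R]_d -> {RV P >-> R},
     (forall x : 'cV[R]_d,
        is_stable_integral alpha Z (ma_kernel E phi alpha H x) (X x)) ->
     stochastically_continuous X).
Proof.
split=> [x|X XP x0 eps e0].
  exact/(stable_integral_existence halpha0 hZ)/(ma_kernel_Lalpha hd hN0 hbeta).
have [C C0 distC] := ma_kernel_dist hd hN0 hbeta hphi_hom hphi_adm halpha0 hH0 hHbeta.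
pose K := markov_const alpha * (eps / 3)^-1 `^ alpha * (2 `^ alpha * 2 `^ alpha).
have K0 : 0 <= K by rewrite !mulr_ge0 ?powR_ge0// ltW// markov_const_gt0.
have [phi_cont phi_ge0 _ _] := hphi_adm.
have phi_cvg : phi @ nbhs (0 : 'cV[R]_d) --> (0 : R).
  by have := phi_cont 0; rewrite /continuous_at (homogeneous0 hd hN0 hphi_hom hphi_adm).
have phi_small := @powR_cvg0_comp _ _ (mulr_gt0 hH0 halpha0) _ _ (nbhs_filter _) _ phi_ge0 phi_cvg.
have shift_cvg : (fun x => x - x0) @ nbhs x0 --> nbhs (0 : 'cV[R]_d).
  by rewrite -(subrr x0); apply: cvgB; [exact: cvg_id|exact: cvg_cst].
have bound_cvg : (fun x => K * C * phi (x - x0) `^ (H * alpha)) @ nbhs x0 --> (0 : R).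
  rewrite -(mulr0 (K * C)); apply: cvgMr.
  exact: (cvg_comp _ _ shift_cvg phi_small).
apply: ereal_cvg0 => [x|e e_gt0]; first exact: measure_ge0.
move/cvgrPdist_le : bound_cvg => /(_ e e_gt0).
apply: filterS => x; rewrite sub0r normrN => xe.
apply: (le_trans (stable_integral_dist halpha0 hZ e0 (XP x) (XP x0))).
apply: (@le_trans _ _ (K%:E * (C * phi (x - x0) `^ (H * alpha))%:E)%E).
  by apply: lee_wpmul2l; [rewrite lee_fin|exact: distC].
by rewrite -EFinM lee_fin mulrA (le_trans (ler_norm _)).
Qed.
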